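(* Let $E$ be a Banach lattice and let $\rho\in E_+$. Let $-A$ and $-B$ be generators of $C_0$-semigroups $(e^{-tA})_{t\ge0}$ and $(e^{-tB})_{t\ge0}$ on $E$ such that $(e^{-tA})_{t\ge 0}$ is dominated by $(e^{-tB})_{t\ge 0}$. Then each eigenpair $(\lambda,\varphi)$ of $A$ such that $\varphi\in E_\rho$ satisfies $$|\varphi|\le \|\varphi\|_\rho \inf_{\operatorname{Re}\mu>\max\{s(-A),s(-B)\}}|\operatorname{Re}(\lambda+\mu)|\,(\operatorname{Re}\mu+B)^{-1}\rho$$ and $$|\varphi|\le \|\varphi\|_\rho \inf_{t>0} e^{t\operatorname{Re}\lambda}\, e^{-tB}\rho .$$ One can take $A=B$ if $(e^{-tA})_{t\ge0}$ is positive: in particular, in that case $$|\varphi|\le \|\varphi\|_\rho\inf_{\delta>0}\bigl(\operatorname{Re}\lambda+s(-A)+\delta\bigr)\bigl[(s(-A)+\delta+A)^{-1}\rho\bigr]\quad\text{and}\quad |\varphi|\le\|\varphi\|_\rho\inf_{t>0}e^{t\operatorname{Re}\lambda}e^{-tA}\rho .$$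
   Context: For $\rho\in E_+$, $E_\rho:=\{f\in E:\exists c\ge 0\text{ with }|f|\le c\rho\}$ with gauge norm $\|f\|_\rho:=\inf\{c\ge0:|f|\le c\rho\}$. For an operator $T$, $s(T):=\sup\{\operatorname{Re}\lambda:\lambda\in\sigma(T)\}$ is the spectral bound. A semigroup $(e^{-tA})_{t\ge0}$ is dominated by $(e^{-tB})_{t\ge0}$ if $|e^{-tA}f|\le e^{-tB}|f|$ for all $f\in E$ and $t\ge0$. An eigenpair of $A$ is $(\lambda,\varphi)$ with $0\ne\varphi\in D(A)$, $A\varphi=\lambda\varphi$. Spectral notions refer to the complex Banach lattice setting. The infima over the parameters $\mu$, $t$, $\delta$ are understood in a pointwise sense (they need not be elements of $E_\rho$), i.e. each estimate means that the inequality between $|\varphi|$ and the expression on the right holds for every admissible value of the parameter. *)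

(* Defs.v *)
From HB Require Import structures.
From mathcomp Require Import all_boot all_order all_algebra complex.
From mathcomp Require Import all_classical all_reals all_analysis.

Set Implicit Arguments.
Unset Strict Implicit.
Unset Printing Implicit Defensive.

Import Order.TTheory GRing.Theory Num.Theory.
Import numFieldNormedType.Exports.

Local Open Scope classical_set_scope.
Local Open Scope ring_scope.
Local Open Scope complex_scope.

Definition cone_le {E : zmodType} (P : set E) (f g : E) : Prop := P (g - f).

(* A complex Banach lattice is the complexification E = X + iX of a real Banach
   lattice X, with |f| = sup {Re (c f) : |c| = 1} and || f || = || |f| ||.
   Here X is the set of fixed points of the projection [reE], and the order is
   given by the positive cone [Epos] of X: f <= g iff g - f is in [Epos], so
   elements with different imaginary parts are incomparable, an upper bound of
   a real element is real, and [modulus f] is a supremum in X.  For f in X it is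
   the supremum of f and - f, so X is a vector lattice.  Completeness of X
   follows from that of E, since |reE f| <= |f|; `|_| is the norm of E. *)
HB.mixin Record CompleteNormedModule_isComplexBanachLattice (R : realType) E
    & CompleteNormedModule R[i] E := {
  reE : E -> E ;
  reE_linear : forall (a : R) (f g : E),
    reE (a%:C *: f + g) = a%:C *: reE f + reE g ;
  reEK : forall f : E, reE (reE f) = reE f ;
  reE_decomp : forall f : E, f = reE f + 'i *: reE (- 'i *: f) ;
  Epos : set E ;
  Epos_real : forall f : E, Epos f -> reE f = f ;
  Epos0 : Epos 0 ;
  EposD : forall f g : E, Epos f -> Epos g -> Epos (f + g) ;
  EposZ : forall (a : R) (f : E), 0 <= a -> Epos f -> Epos (a%:C *: f) ;
  Epos_proper : forall f : E, Epos f -> Epos (- f) -> f = 0 ;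
  modulus : E -> E ;
  modulus_ub : forall (f : E) (c : R[i]),
    `|c| = 1 -> cone_le Epos (reE (c *: f)) (modulus f) ;
  modulus_least : forall f g : E,
    (forall c : R[i], `|c| = 1 -> cone_le Epos (reE (c *: f)) g) ->
    cone_le Epos (modulus f) g ;
  le_modulus_norm : forall f g : E,
    cone_le Epos (modulus f) (modulus g) -> `|f| <= `|g|
}.

#[short(type="complexBanachLatticeType")]
HB.structure Definition ComplexBanachLattice (R : realType) :=
  { E of CompleteNormedModule_isComplexBanachLattice R E
       & CompleteNormedModule R[i] E }.

Notation "f <=E g" := (cone_le Epos f g) (at level 70, no associativity).

Section UnboundedOperators.
Context {R : realType} {E : completeNormedModType R[i]}.

(* Values of [op_fun] outside [op_dom] are irrelevant. *)
Record operator := Operator {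
  op_dom : set E ;
  op_fun :> E -> E ;
  op_dom0 : op_dom 0 ;
  op_domP : forall (a : R[i]) (f g : E),
    op_dom f -> op_dom g -> op_dom (a *: f + g) ;
  op_linear : forall (a : R[i]) (f g : E), op_dom f -> op_dom g ->
    op_fun (a *: f + g) = a *: op_fun f + op_fun g
}.

Fact shift_op_linear (z : R[i]) (T : operator) (a : R[i]) (f g : E) :
  op_dom T f -> op_dom T g ->
  z *: (a *: f + g) + T (a *: f + g) = a *: (z *: f + T f) + (z *: g + T g).
Proof.
move=> Df Dg; rewrite (op_linear a Df Dg) !scalerDr !scalerA (mulrC z a).
by rewrite addrACA.
Qed.

(* z + T, with domain D(T) *)
Definition shift_op (z : R[i]) (T : operator) : operator :=
  Operator (op_dom0 T) (@op_domP T) (@shift_op_linear z T).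

Fact opp_op_linear (T : operator) (a : R[i]) (f g : E) :
  op_dom T f -> op_dom T g -> - T (a *: f + g) = a *: - T f + - T g.
Proof. by move=> Df Dg; rewrite (op_linear a Df Dg) opprD scalerN. Qed.

Definition opp_op (T : operator) : operator :=
  Operator (op_dom0 T) (@op_domP T) (@opp_op_linear T).

Definition boundedly_invertible (T : operator) : Prop :=
  (forall f, exists! u, op_dom T u /\ T u = f) /\
  (exists M : R, forall u, op_dom T u -> `|u| <= M%:C * `|T u|).

(* T^-1 f; the value 0 is a dummy when f has no preimage *)
Definition inv_op (T : operator) (f : E) : E :=
  xget 0 [set u | op_dom T u /\ T u = f].

Definition resolvent_set (T : operator) : set R[i] :=
  [set z | boundedly_invertible (shift_op z (opp_op T))].

Definition spectrum (T : operator) : set R[i] := ~` resolvent_set T.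

(* equal to -oo when the spectrum is empty *)
Definition spectral_bound (T : operator) : \bar R :=
  ereal_sup [set (complex.Re z)%:E | z in spectrum T].

Definition eigenpair (T : operator) (lambda : R[i]) (phi : E) : Prop :=
  [/\ phi != 0, op_dom T phi & T phi = lambda *: phi].

(* Only the values S t with 0 <= t matter. *)
Record C0_semigroup (S : R -> {linear E -> E}) : Prop := {
  semigroup_continuous : forall t, 0 <= t -> continuous (S t) ;
  semigroup0 : forall f, S 0 f = f ;
  semigroupD : forall s t f, 0 <= s -> 0 <= t -> S (s + t) f = S s (S t f) ;
  semigroup_strongly_continuous : forall f, S t f @[t --> 0^'+] --> f
}.

Definition generator (S : R -> {linear E -> E}) (G : operator) : Prop :=
  forall f g, (op_dom G f /\ G f = g) <->
    ((t^-1)%:C *: (S t f - f) @[t --> 0^'+] --> g).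

End UnboundedOperators.
Arguments operator {R} E.

Section Lattice.
Context {R : realType} {E : complexBanachLatticeType R}.

Definition dominated (S T : R -> {linear E -> E}) : Prop :=
  forall t f, 0 <= t -> modulus (S t f) <=E T t (modulus f).

Definition positive_semigroup (S : R -> {linear E -> E}) : Prop :=
  forall t f, 0 <= t -> Epos f -> Epos (S t f).

Definition gauge_space (rho : E) : set E :=
  [set f | exists2 c : R, 0 <= c & modulus f <=E c%:C *: rho].

Definition gauge_norm (rho f : E) : R :=
  inf [set c : R | 0 <= c /\ modulus f <=E c%:C *: rho].

End Lattice.

(* Main.v *)
(* For an eigenpair, e^{t lambda} S t phi = phi, so domination makes
   psi = |phi| superinvariant: psi <= e^{t Re lambda} T t psi for all t.  With
   psi <= ||phi||_rho rho and T t >= 0 this is the second estimate.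

   For the first one, let m be real, m > s(-B), and u = (m + B)^-1 psi.  Writing
   V t = e^{t Re lambda} T t, the difference (m + Re lambda) u - psi is
   the limit of (V t u - u)/t = (m + B)^-1 (V t psi - psi)/t, which is positive
   as soon as (m + B)^-1 is.  Positivity of the resolvent up to the spectral
   bound, not only beyond the growth bound, needs no Laplace transform: it holds
   for large m and propagates to the left through the expansion
   (m - h - G)^-1 = \sum_k h^k ((m - G)^-1)^(k+1), whose terms are positive.

   Finiteness of s(-A) needs a half-plane of resolvent points: with
   J f = \int_0^1 e^{-zt} S t f dt, a limit of Riemann sums, one has
   (z - G) J = 1 - e^{-z} S 1, which is invertible for large Re z. *)
Require Import Defs.
From HB Require Import structures.
From mathcomp Require Import all_boot all_order all_algebra complex.
From mathcomp Require Import all_classical all_reals all_analysis.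
From mathcomp Require Import ring lra.

Set Implicit Arguments.
Unset Strict Implicit.
Unset Printing Implicit Defensive.

Import Order.TTheory GRing.Theory Num.Theory.
Import numFieldNormedType.Exports.

Local Open Scope classical_set_scope.
Local Open Scope ring_scope.
Local Open Scope complex_scope.

(** * Real-valued norms *)

Section RealNorm.
Context {R : realType} {E : normedModType R[i]}.
Implicit Types (f g : E) (a : R[i]) (r : R).

(** The norm takes values in [R[i]], which is only partially ordered; its real part lives in the
    totally ordered field [R]. *)
Definition rnorm f : R := complex.Re `|f|.

Lemma rnormE f : (rnorm f)%:C = `|f|.
Proof. by rewrite /rnorm RRe_real. Qed.

Lemma rnorm_ge0 f : 0 <= rnorm f.
Proof. by rewrite -lecR rnormE normr_ge0. Qed.

Lemma rnorm0 : rnorm 0 = 0.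
Proof. by rewrite /rnorm normr0. Qed.

Lemma rnorm0_eq0 f : rnorm f = 0 -> f = 0.
Proof. by move=> f0; apply/eqP; rewrite -normr_eq0 -rnormE f0. Qed.

Lemma ler_rnormD f g : rnorm (f + g) <= rnorm f + rnorm g.
Proof. by rewrite -lecR rmorphD /= !rnormE ler_normD. Qed.

Lemma rnormN f : rnorm (- f) = rnorm f.
Proof. by rewrite /rnorm normrN. Qed.

Lemma ler_rnormB f g : rnorm (f - g) <= rnorm f + rnorm g.
Proof. by rewrite -(rnormN g) ler_rnormD. Qed.

Lemma rnormBC f g : rnorm (f - g) = rnorm (g - f).
Proof. by rewrite -rnormN opprB. Qed.

Lemma ler_rnorm_dist g f h : rnorm (f - h) <= rnorm (f - g) + rnorm (g - h).
Proof. by rewrite -[X in rnorm X](subrKA g) ler_rnormD. Qed.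

Lemma rnormZ a f : rnorm (a *: f) = complex.Re `|a| * rnorm f.
Proof.
by apply: complexI; rewrite rmorphM /= !rnormE normrZ.
Qed.

Lemma rnormZr r f : rnorm (r%:C *: f) = `|r| * rnorm f.
Proof. by rewrite rnormZ normc_def /= expr0n /= addr0 sqrtr_sqr. Qed.

Lemma ler_rnorm_sum n (F : 'I_n -> E) :
  rnorm (\sum_(i < n) F i) <= \sum_(i < n) rnorm (F i).
Proof.
elim/big_ind2 : _ => [|f r g s fr gs|//]; first by rewrite rnorm0.
by rewrite (le_trans (ler_rnormD _ _)) // lerD.
Qed.

Lemma rnorm_small_eq0 f : (forall e, 0 < e -> rnorm f <= e) -> f = 0.
Proof.
move=> fe; apply/rnorm0_eq0/eqP; rewrite eq_le rnorm_ge0 andbT.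
by apply/ler_addgt0Pr => e /fe; rewrite add0r.
Qed.

(** A positive element of [R[i]] has zero imaginary part, so real tolerances suffice. *)
Lemma cvg_rnormP T (F : set_system T) (FF : Filter F) (u : T -> E) f :
  u x @[x --> F] --> f <->
  forall e : R, 0 < e -> \forall x \near F, rnorm (f - u x) < e.
Proof.
split=> [/cvgrPdist_lt uf e e0|uf].
  have := uf e%:C; rewrite ltcR => /(_ e0).
  by apply: filterS => x; rewrite -rnormE ltcR.
apply/cvgrPdist_lt => -[a b]; rewrite ltcE /= => /andP[/eqP-> /uf].
by apply: filterS => x; rewrite -rnormE ltcR.
Qed.

Lemma cvg0_rnormP (u : R -> E) f :
  u x @[x --> 0^'+] --> f <->
  forall e, 0 < e ->
    exists2 d, 0 < d & forall t, 0 < t -> t <= d -> rnorm (u t - f) <= e.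
Proof.
split=> [/cvg_rnormP uf e /uf|uf].
  move=> [d /= d0 ud]; exists (d / 2); first by rewrite divr_gt0.
  move=> t t0 td; rewrite rnormBC ltW //; apply: ud => //=.
  by rewrite sub0r normrN gtr0_norm // (le_lt_trans td) // ltr_pdivrMr //; lra.
apply/cvg_rnormP => e e0.
have [|d d0 ud] := uf (e / 2); first by rewrite divr_gt0.
near=> t; rewrite rnormBC (@le_lt_trans _ _ (e / 2)) //; last lra.
apply: ud.
- by near: t; exact: nbhs_right_gt.
- by near: t; exact: nbhs_right_ltW.
Unshelve. all: by end_near. Qed.

End RealNorm.

(** * Geometric convergence and Neumann series *)

Section Complete.
Context {R : realType} {E : completeNormedModType R[i]}.

Lemma rnorm_cauchy (u : nat -> E) :
  (forall e : R, 0 < e -> exists N, forall n, (N <= n)%N ->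
     rnorm (u n - u N) <= e) ->
  exists l, forall e : R, 0 < e -> exists N, forall n, (N <= n)%N ->
     rnorm (u n - l) <= e.
Proof.
move=> cu.
have : cvg (u x @[x --> \oo]).
  apply/cauchy_cvgP/cauchy_exP => -[e b]; rewrite ltcE /= => /andP[/eqP-> e0].
  have [|N uN] := cu (e / 2); first by rewrite divr_gt0.
  exists (u N); exists N => // n /= /uN uNn; rewrite -ball_normE /ball_ /=.
  by rewrite -rnormE ltcR rnormBC (le_lt_trans uNn) //; lra.
move=> /cvg_ex[l /cvg_rnormP ul]; exists l => e /ul [N _ uN].
by exists N => n /uN /ltW; rewrite rnormBC.
Qed.

Lemma geometric_small (C q e : R) : 0 <= q < 1 -> 0 < e ->
  exists N, C * q ^+ N <= e.
Proof.
move=> /andP[q0 q1] e0.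
have : geometric C q n @[n --> \oo] --> (0 : R).
  by apply: cvg_geometric; rewrite ger0_norm.
move=> /cvgrPdist_le /(_ _ e0)[N _ /(_ N (leqnn N))] /=.
by rewrite sub0r normrN; exists N; rewrite (le_trans (ler_norm _)).
Qed.

Lemma geometric_cvg (u : nat -> E) (C q : R) : 0 <= q < 1 ->
  (forall n, rnorm (u n.+1 - u n) <= C * q ^+ n) ->
  exists l, forall n, rnorm (l - u n) <= C / (1 - q) * q ^+ n.
Proof.
move=> /[dup] q01 /andP[q0 q1] uC.
have C0 : 0 <= C by have := le_trans (rnorm_ge0 _) (uC 0%N); rewrite mulr1.
have q1' : 0 < 1 - q by rewrite subr_gt0.
(* The factor [1 - q ^+ k] gives the exact finite geometric sum, so that the induction closes; it is
   then bounded by 1. *)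
have uD n k : rnorm (u (n + k)%N - u n) <= C / (1 - q) * q ^+ n * (1 - q ^+ k).
  elim: k => [|k ih]; first by rewrite addn0 !subrr rnorm0 mulr0.
  rewrite addnS (le_trans (ler_rnorm_dist (u (n + k)%N) _ _)) //.
  rewrite (le_trans (lerD (uC _) ih)) // exprD exprS le_eqVlt; apply/orP; left.
  by apply/eqP; field; rewrite gt_eqF.
have {}uD n k : rnorm (u (n + k)%N - u n) <= C / (1 - q) * q ^+ n.
  rewrite (le_trans (uD _ _)) // ler_piMr ?gerBl ?exprn_ge0 //.
  by rewrite mulr_ge0 ?exprn_ge0 // divr_ge0 // ltW.
have [|l ul] := @rnorm_cauchy u.
  move=> e e0; have [N Ne] := geometric_small (C / (1 - q)) q01 e0.
  by exists N => n /subnKC <-; rewrite (le_trans (uD _ _)).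
exists l => n; apply/ler_addgt0Pr => e /ul[N uN].
rewrite (le_trans (ler_rnorm_dist (u (n + N)%N) _ _)) // addrC lerD //.
by rewrite rnormBC uN // leq_addl.
Qed.

(** The iterates of [g |-> f + P g] from 0 are the partial sums of the Neumann series for
    [(1 - P)^-1 f]. *)
Lemma contraction_surj (P : {linear E -> E}) (q : R) : 0 <= q < 1 ->
  (forall f, rnorm (P f) <= q * rnorm f) ->
  forall f, exists w, w - P w = f.
Proof.
move=> /[dup] q01 /andP[q0 q1] Pq f.
pose w n := iter n (fun g => f + P g) 0.
have wE n : w n.+1 = f + P (w n) by [].
have wS n : rnorm (w n.+1 - w n) <= rnorm f * q ^+ n.
  elim: n => [|n ih]; first by rewrite /w /= linear0 addr0 subr0 mulr1.
  rewrite !wE opprD addrACA subrr add0r -linearB -wE.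
  by rewrite (le_trans (Pq _)) // exprS mulrCA ler_wpM2l.
have [l wl] := geometric_cvg q01 wS.
exists l; apply/eqP; rewrite -subr_eq0; apply/eqP/rnorm_small_eq0 => e e0.
have [N Ne] := geometric_small (rnorm f / (1 - q) * (q + q)) q01 e0.
apply: le_trans Ne; have -> : l - P l - f = l - w N.+1 - P (l - w N).
  by rewrite wE linearB !opprD opprK !addrA [RHS]addrAC subrK addrAC.
rewrite (le_trans (ler_rnormB _ _)) // mulrDr mulrDl lerD //.
  by rewrite (le_trans (wl _)) // exprS mulrA.
by rewrite (le_trans (Pq _)) // mulrAC [leRHS]mulrC ler_wpM2l.
Qed.

End Complete.

(** * Order in complex Banach lattices *)

Section ConeOrder.
Context {R : realType} {E : complexBanachLatticeType R}.
Implicit Types (f g h : E) (r : R).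

Lemma cone_lexx f : f <=E f.
Proof. by rewrite /cone_le subrr; exact: Epos0. Qed.

Lemma cone_le0 f : 0 <=E f <-> Epos f.
Proof. by rewrite /cone_le subr0. Qed.

Lemma cone_le_trans g f h : f <=E g -> g <=E h -> f <=E h.
Proof. by move=> fg gh; rewrite /cone_le -(subrKA g) addrC; exact: EposD. Qed.

Lemma cone_leD f1 f2 g1 g2 : f1 <=E g1 -> f2 <=E g2 -> f1 + f2 <=E g1 + g2.
Proof. by move=> l1 l2; rewrite /cone_le opprD addrACA; exact: EposD. Qed.

Lemma cone_leZ r f g : 0 <= r -> f <=E g -> r%:C *: f <=E r%:C *: g.
Proof. by move=> r0 fg; rewrite /cone_le -scalerBr; exact: EposZ. Qed.

Lemma cone_leZr r s f : r <= s -> Epos f -> r%:C *: f <=E s%:C *: f.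
Proof.
move=> rs f0; rewrite /cone_le -scalerBl -rmorphB.
by apply: EposZ => //; rewrite subr_ge0.
Qed.

Lemma Epos_sum n (F : 'I_n -> E) :
  (forall i, Epos (F i)) -> Epos (\sum_(i < n) F i).
Proof. by move=> F0; elim/big_ind : _ => //; [exact: Epos0|exact: EposD]. Qed.

Lemma Epos_le f g : Epos f -> f <=E g -> Epos g.
Proof. by move=> /cone_le0 f0 fg; apply/cone_le0/(cone_le_trans f0). Qed.

Lemma cone_le_anti f g : f <=E g -> g <=E f -> f = g.
Proof.
move=> fg gf; apply/eqP; rewrite -subr_eq0; apply/eqP/Epos_proper => //.
by rewrite opprB.
Qed.

Lemma reED f g : reE (f + g) = reE f + reE g.
Proof. by have := reE_linear 1 f g; rewrite !scale1r. Qed.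

Lemma reE0 : reE (0 : E) = 0.
Proof. by apply: (addrI (reE 0)); rewrite -reED !addr0. Qed.

Lemma reEZ r f : reE (r%:C *: f) = r%:C *: reE f.
Proof. by have := reE_linear r f 0; rewrite reE0 !addr0. Qed.

Lemma reEB f g : reE (f - g) = reE f - reE g.
Proof.
rewrite reED -scaleN1r -(rmorph1 (real_complex R)) -rmorphN reEZ.
by rewrite rmorphN rmorph1 scaleN1r.
Qed.

Lemma reEN f : reE (- f) = - reE f.
Proof. by rewrite -sub0r reEB reE0 sub0r. Qed.

Lemma reE_i f : reE f = f -> reE ('i *: f) = 0.
Proof.
move=> rf; have := reE_decomp f; rewrite rf scaleNr reEN scalerN => /eqP.
rewrite eq_sym -subr_eq0 addrAC subrr add0r oppr_eq0 scaler_eq0 => /orP[|/eqP//].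
by rewrite eq_complex /= oner_eq0 andbF.
Qed.

Lemma reE_real (c : R[i]) f : reE f = f -> reE (c *: f) = (complex.Re c)%:C *: f.
Proof.
move=> rf; rewrite {1}[c]complexE scalerDl -scalerA reED reEZ rf.
rewrite [X in _ + X = _](_ : _ = 0) ?addr0 //.
by rewrite scalerA mulrC -scalerA reEZ reE_i // scaler0.
Qed.

Lemma halfD f : (2^-1)%:C *: (f + f) = f.
Proof.
rewrite -{1 2}[f]scale1r -scalerDl scalerA -(rmorph1 (real_complex R)).
by rewrite -rmorphD -rmorphM /= mulVf ?scale1r // pnatr_eq0.
Qed.

Lemma Epos_half f : Epos (f + f) -> Epos f.
Proof. by rewrite -{3}[f]halfD; apply: EposZ; rewrite invr_ge0. Qed.

Lemma reE_le_modulus f : reE f <=E modulus f.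
Proof. by have := @modulus_ub _ _ f 1 (normr1 _); rewrite scale1r. Qed.

Lemma reEN_le_modulus f : - reE f <=E modulus f.
Proof. by have := @modulus_ub _ _ f (-1) (normrN1 _); rewrite scaleN1r reEN. Qed.

Lemma modulus_ge0 f : Epos (modulus f).
Proof.
apply: Epos_half; have := cone_leD (reE_le_modulus f) (reEN_le_modulus f).
by rewrite subrr => /cone_le0.
Qed.

(** Twice [g - r f] equals (1 + r)(g - f) + (1 - r)(g + f), a sum of positive elements. *)
Lemma cone_le_convex r f g : f <=E g -> - f <=E g -> `|r| <= 1 ->
  r%:C *: f <=E g.
Proof.
move=> fg nfg; rewrite ler_norml => /andP[r1 r2]; apply: Epos_half.
have -> : g - r%:C *: f + (g - r%:C *: f) =
    (1 + r)%:C *: (g - f) + (1 - r)%:C *: (g - - f).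
  rewrite opprK rmorphB rmorphD rmorph1 scalerBl scalerDl !scale1r.
  rewrite [RHS]addrACA -scalerBr (_ : g - f - (g + f) = - f - f); last first.
    by rewrite opprD addrACA subrr add0r.
  by rewrite addrACA (addrACA g (- f)) addNr addr0 scalerDr scalerN.
by apply: EposD; apply: EposZ => //; lra.
Qed.

Lemma Epos_reE f : Epos f -> reE f = f.
Proof. exact: Epos_real. Qed.

(** For real f, the real part of c f is (Re c) f with |Re c| <= 1, so the two signs control every
    rotation. *)
Lemma modulus_real_le f g : reE f = f -> f <=E g -> - f <=E g ->
  modulus f <=E g.
Proof.
move=> rf fg nfg; apply: modulus_least => c c1; rewrite reE_real //.
apply: cone_le_convex => //; rewrite -lecR.
by rewrite (le_trans (normc_ge_Re c)) // c1.
Qed.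

Lemma Epos_oppr_le f : Epos f -> - f <=E f.
Proof. by move=> f0; rewrite /cone_le opprK; exact: EposD. Qed.

Lemma modulus_pos f : Epos f -> modulus f = f.
Proof.
move=> f0; apply: cone_le_anti.
  apply: modulus_real_le; [exact: Epos_real|exact: cone_lexx|].
  exact: Epos_oppr_le.
by rewrite -{1}(Epos_reE f0); exact: reE_le_modulus.
Qed.

Lemma modulusD_le f g : modulus (f + g) <=E modulus f + modulus g.
Proof.
apply: modulus_least => c c1; rewrite scalerDr reED.
by apply: cone_leD; exact: modulus_ub.
Qed.

Lemma modulusZ_le (a : R[i]) f :
  modulus (a *: f) <=E (complex.Re `|a|)%:C *: modulus f.
Proof.
apply: modulus_least => c c1; have [->|a0] := eqVneq a 0.
  rewrite scale0r scaler0 reE0 normr0 /= scale0r; exact: cone_lexx.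
have na0 : `|a| != 0 by rewrite normr_eq0.
(* The phase of [a] is absorbed into the unimodular factor [c]. *)
have -> : c *: (a *: f) = (complex.Re `|a|)%:C *: ((c * (a / `|a|)) *: f).
  rewrite !scalerA; congr (_ *: _); rewrite RRe_real ?normr_real //.
  by rewrite mulrCA [`|a| * _]mulrC divfK.
rewrite reEZ; apply: cone_leZ; first by rewrite -lecR RRe_real ?normr_ge0 ?normr_real.
by apply: modulus_ub; rewrite !normrM c1 normfV normr_id mul1r divff.
Qed.

Lemma le_rnorm f g : modulus f <=E modulus g -> rnorm f <= rnorm g.
Proof. by move/le_modulus_norm; rewrite -lecR !rnormE. Qed.

Lemma rnorm_modulus f : rnorm (modulus f) = rnorm f.
Proof.
have mK : modulus (modulus f) = modulus f by exact/modulus_pos/modulus_ge0.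
by apply/eqP; rewrite eq_le !le_rnorm // mK; exact: cone_lexx.
Qed.

Lemma rnorm_reE f : rnorm (reE f) <= rnorm f.
Proof.
apply/le_rnorm/modulus_real_le; first exact: reEK.
- exact: reE_le_modulus.
- exact: reEN_le_modulus.
Qed.

(* The negative part of f is at most |f - g| for every g >= 0. *)
Lemma Epos_closed f :
  (forall e : R, 0 < e -> exists2 g, Epos g & rnorm (f - g) <= e) -> Epos f.
Proof.
move=> fP.
have rf : reE f = f.
  apply/eqP; rewrite -subr_eq0; apply/eqP/rnorm_small_eq0 => e e0.
  have [|g g0 fg] := fP (e / 2); first by rewrite divr_gt0.
  rewrite (le_trans (ler_rnorm_dist g _ _)) // -{1}(Epos_reE g0) -reEB.
  rewrite (rnormBC g) (le_trans (lerD (rnorm_reE _) (lexx _))) //; lra.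
have mf0 : Epos (modulus f - f) by rewrite -{2}rf; exact: reE_le_modulus.
suff -> : f = modulus f by exact: modulus_ge0.
apply/esym/eqP; rewrite -subr_eq0; apply/eqP/rnorm_small_eq0 => e e0.
have [|g g0 fg] := fP (e / 2); first by rewrite divr_gt0.
pose m := modulus (f - g).
have m0 : Epos (m + m) by apply: EposD; exact: modulus_ge0.
(* [modulus f - f] is twice the negative part of f, hence the doubled bound. *)
suff : rnorm (modulus f - f) <= rnorm (m + m).
  move/le_trans; apply; rewrite (le_trans (ler_rnormD _ _)) //.
  by rewrite rnorm_modulus; lra.
apply: le_rnorm; rewrite (modulus_pos mf0) (modulus_pos m0).
apply: (@cone_le_trans (m + (g - f))).
  rewrite addrA; apply: cone_leD (cone_lexx _).
  by have := modulusD_le (f - g) g; rewrite subrK (modulus_pos g0).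
apply: cone_leD (cone_lexx _) _.
by have := reEN_le_modulus (f - g); rewrite reEB rf (Epos_reE g0) opprB.
Qed.

(** The infimum defining the gauge norm is attained because the positive cone is closed. *)
Lemma gauge_norm_le rho f : gauge_space rho f ->
  0 <= gauge_norm rho f /\ modulus f <=E (gauge_norm rho f)%:C *: rho.
Proof.
move=> [c c0 fc]; pose G := [set c : R | 0 <= c /\ modulus f <=E c%:C *: rho].
have infG : has_inf G by split; [exists c|exists 0 => r []].
have G0 : 0 <= gauge_norm rho f by apply: lb_le_inf; [exists c|move=> r []].
split => //; apply: Epos_closed => e e0.
(* The added 1 keeps the denominator positive when [rho] is 0. *)
have d0 : 0 < e / (rnorm rho + 1) by rewrite divr_gt0 // ltr_wpDl ?rnorm_ge0.
have [b [b0 fb] bG] := inf_adherent d0 infG.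
exists (b%:C *: rho - modulus f) => //.
rewrite opprB addrA subrK -scalerBl -rmorphB rnormZr.
have : gauge_norm rho f <= b by apply: ge_inf => //; exact: infG.2.
rewrite -subr_le0 => /ler0_norm ->; rewrite opprB.
have {}bG : b - gauge_norm rho f <= e / (rnorm rho + 1) by rewrite /gauge_norm -/G; lra.
rewrite (le_trans (ler_wpM2r (rnorm_ge0 _) bG)) // mulrAC ler_pdivrMr ?ltr_wpDl ?rnorm_ge0 //.
by rewrite ler_wpM2l ?lerDl ?ltW.
Qed.

End ConeOrder.

(** * The complex exponential and its right derivative at 0 *)

Section ComplexExponential.
Context {R : realType}.
Implicit Types (z : R[i]) (t : R).

(** This is e^{tz}, split into modulus and phase. *)
Definition cexp z t : R[i] :=
  (expR (t * complex.Re z))%:C *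
  (cos (t * complex.Im z) +i* sin (t * complex.Im z)).

Lemma cexpE z t : cexp z t =
  expR (t * complex.Re z) * cos (t * complex.Im z) +i*
  (expR (t * complex.Re z) * sin (t * complex.Im z)).
Proof. by rewrite /cexp; simpc. Qed.

Lemma cexp0 z : cexp z 0 = 1.
Proof. by rewrite cexpE !mul0r expR0 cos0 sin0 mulr1 mulr0. Qed.

Lemma cexpD z s t : cexp z (s + t) = cexp z s * cexp z t.
Proof.
rewrite !cexpE !mulrDl expRD cosD sinD; simpc.
by congr (_ +i* _); ring.
Qed.

Lemma cexpN z t : cexp (- z) t = cexp z (- t).
Proof. by case: z => a b; rewrite !cexpE /= !mulrN !mulNr. Qed.

Lemma cexpK z t : cexp (- z) t * cexp z t = 1.
Proof. by rewrite cexpN -cexpD addNr cexp0. Qed.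

Lemma cexp_real (a t : R) : cexp a%:C t = (expR (t * a))%:C.
Proof. by rewrite cexpE /= mulr0 cos0 sin0 mulr1 mulr0. Qed.

Lemma norm_cexp z t : complex.Re `|cexp z t| = expR (t * complex.Re z).
Proof.
rewrite /cexp normrM; rewrite [X in _ * X](_ : _ = 1) ?mulr1.
  by rewrite normc_def /= expr0n addr0 sqrtr_sqr ger0_norm ?expR_ge0.
by rewrite normc_def /= cos2Dsin2 sqrtr1.
Qed.

Lemma cvg_complex T (F : set_system T) (FF : Filter F) (u v : T -> R) (a b : R) :
  u x @[x --> F] --> a -> v x @[x --> F] --> b ->
  (u x +i* v x : R[i]^o) @[x --> F] --> (a +i* b : R[i]^o).
Proof.
move=> /cvgrPdist_lt ua /cvgrPdist_lt vb; apply/cvgrPdist_lt => -[e e'].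
rewrite ltcE /= => /andP[/eqP-> e0].
have e20 : 0 < e / 2 by rewrite divr_gt0.
near=> x.
have -> : (a +i* b) - (u x +i* v x) = (a - u x)%:C + 'i * (b - v x)%:C.
  by simpc.
rewrite (le_lt_trans (ler_normD _ _)) // normrM.
have nC (r : R) : `|r%:C| = `|r|%:C.
  by rewrite normc_def /= expr0n addr0 sqrtr_sqr.
rewrite !nC [X in X * _](_ : _ = 1) ?mul1r; last first.
  by rewrite normc_def /= expr0n expr1n add0r sqrtr1.
rewrite -rmorphD ltcR [e]splitr ltrD //.
- by near: x; exact: ua.
- by near: x; exact: vb.
Unshelve. all: by end_near. Qed.

Lemma derive_right (f : R -> R) (d : R) : is_derive (0 : R) 1 f d ->
  (t^-1 * (f t - f 0)) @[t --> 0^'+] --> d.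
Proof.
move=> [fd <-]; apply: cvg_dnbhs_at_right; move: fd; rewrite /derivable /derive.
suff -> : (fun h : R => h^-1 *: ((f \o shift 0) (h *: 1) - f 0)) =
    (fun h => h^-1 * (f h - f 0)) by [].
by apply/funext => h; rewrite /= addr0 -[h *: 1]/(h * 1) mulr1.
Qed.

Lemma is_derive_mulr (a : R) : is_derive (0 : R) 1 (fun t : R => t * a) a.
Proof.
rewrite (_ : (fun t : R => t * a) = a \*: id); last first.
  by apply/funext => t; rewrite /= mulrC.
by apply: is_derive_eq; rewrite -[RHS]mulr1.
Qed.

Lemma cexp_Re_derive (a b : R) :
  is_derive (0 : R) 1 (fun t : R => expR (t * a) * cos (t * b)) a.
Proof.
have da := is_derive_mulr a; have db := is_derive_mulr b.
have dea : is_derive (0 : R) 1 (fun t : R => expR (t * a)) (expR (0 * a) * a).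
  exact: is_derive1_comp.
have dcb : is_derive (0 : R) 1 (fun t : R => cos (t * b)) (- sin (0 * b) * b).
  exact: is_derive1_comp.
apply: is_derive_eq; rewrite !mul0r sin0 cos0 expR0 oppr0 mul0r scaler0 add0r.
by rewrite mul1r scale1r.
Qed.

Lemma cexp_Im_derive (a b : R) :
  is_derive (0 : R) 1 (fun t : R => expR (t * a) * sin (t * b)) b.
Proof.
have da := is_derive_mulr a; have db := is_derive_mulr b.
have dea : is_derive (0 : R) 1 (fun t : R => expR (t * a)) (expR (0 * a) * a).
  exact: is_derive1_comp.
have dsb : is_derive (0 : R) 1 (fun t : R => sin (t * b)) (cos (0 * b) * b).
  exact: is_derive1_comp.
apply: is_derive_eq; rewrite !mul0r sin0 cos0 expR0 scale0r addr0.
by rewrite mul1r scale1r.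
Qed.

Lemma cexp_derive z :
  ((t^-1)%:C * (cexp z t - 1) : R[i]^o) @[t --> 0^'+] --> (z : R[i]^o).
Proof.
case: z => a b.
pose f (t : R) := expR (t * a) * cos (t * b).
pose g (t : R) := expR (t * a) * sin (t * b).
have -> : (fun t => (t^-1)%:C * (cexp (a +i* b) t - 1)) =
    (fun t => (t^-1 * (f t - f 0)) +i* (t^-1 * (g t - g 0))).
  apply/funext => t; rewrite /f /g !mul0r expR0 cos0 sin0 cexpE /= mulr0 mulr1.
  by simpc.
apply: cvg_complex; apply: derive_right.
- exact: cexp_Re_derive.
- exact: cexp_Im_derive.
Qed.

Lemma cvg_cexp z : (cexp z t : R[i]^o) @[t --> 0^'+] --> (1 : R[i]^o).
Proof.
case: z => a b.
have cvgr (f : R -> R) d : is_derive (0 : R) 1 f d -> f t @[t --> 0^'+] --> f 0.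
  move=> [fd _]; apply: cvg_at_right_filter.
  by apply/differentiable_continuous/derivable1_diffP.
have -> : (1 : R[i]) = cexp (a +i* b) 0 by rewrite cexp0.
rewrite cexpE; under eq_fun do rewrite cexpE.
apply: cvg_complex.
- exact: (cvgr _ _ (cexp_Re_derive a b)).
- exact: (cvgr _ _ (cexp_Im_derive a b)).
Qed.

End ComplexExponential.

(** * Semigroups and resolvents *)

Section UniformBoundedness.
Context {R : realType} {E : completeNormedModType R[i]}.
Implicit Types (f g : E) (T : {linear E -> E}).

Lemma continuous_rnorm_bound T : continuous T ->
  exists2 K : R, 0 <= K & forall f, rnorm (T f) <= K * rnorm f.
Proof.
move=> /linear_bounded_continuous/linear_boundedP[M [/RRe_real Mr TM]].
(* The bound holds for every constant strictly above [M], whence the added 1; the maximum ensures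
   nonnegativity. *)
exists (Num.max 0 (complex.Re M) + 1); first by rewrite addr_ge0 // le_max lexx.
move=> f; rewrite -lecR rmorphM /= !rnormE; apply: TM.
by rewrite -Mr ltcR ltr_pwDr // le_max lexx orbT.
Qed.

(** [K] is the operator norm, obtained as an infimum; the third clause supplies the nearly extremal
    vectors of the gliding hump. *)
Lemma linear_opnorm T : continuous T -> exists K : R,
  [/\ 0 <= K, forall f, rnorm (T f) <= K * rnorm f &
      forall c, 0 <= c < K -> exists f, c * rnorm f < rnorm (T f)].
Proof.
move=> /continuous_rnorm_bound[K0 K00 TK0].
pose G := [set c : R | 0 <= c /\ forall f, rnorm (T f) <= c * rnorm f].
have G0 : G !=set0 by exists K0.
have lbG : has_lbound G by exists 0 => c [].
exists (inf G); split.
- by apply: lb_le_inf => // c [].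
- move=> f; have [f0|f0] := eqVneq (rnorm f) 0.
    by have := TK0 f; rewrite f0 !mulr0.
  have {}f0 : 0 < rnorm f by rewrite lt_def f0 rnorm_ge0.
  rewrite -ler_pdivrMr //; apply: lb_le_inf => // c [_ cT].
  by rewrite ler_pdivrMr.
- move=> c /andP[c0 cG]; apply/not_existsP => Tc.
  suff : inf G <= c by rewrite leNgt cG.
  by apply: ge_inf => //; split => // f; rewrite leNgt; exact/negP.
Qed.

(** Since 2 T g = T (f + g) - T (f - g), a vector g of norm r with large image makes the image of f
    + g or of f - g large. *)
Lemma ball_large T f (r c : R) : 0 <= r -> 0 <= c ->
  (exists g, c * rnorm g < rnorm (T g)) ->
  exists g, rnorm (g - f) <= r /\ c * r <= rnorm (T g).
Proof.
move=> r0 c0 [g0 cg0].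
have g00 : 0 < rnorm g0.
  rewrite lt_def rnorm_ge0 andbT; apply: contraTneq cg0 => /rnorm0_eq0 ->.
  by rewrite linear0 rnorm0 mulr0 ltxx.
pose g := (r / rnorm g0)%:C *: g0.
have gr : rnorm g = r.
  by rewrite /g rnormZr ger0_norm ?divr_ge0 ?rnorm_ge0 // divfK ?gt_eqF.
have cg : c * r <= rnorm (T g).
  rewrite /g linearZ /= rnormZr ger0_norm ?divr_ge0 ?rnorm_ge0 //.
  by rewrite mulrAC ler_pdivlMr // (mulrC c) -mulrA ler_wpM2l // ltW.
have [l1|l1] := leP (c * r) (rnorm (T (f + g))).
  by exists (f + g); rewrite addrAC subrr add0r gr.
have [l2|l2] := leP (c * r) (rnorm (T (f - g))).
  by exists (f - g); rewrite addrAC subrr add0r rnormN gr.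
suff : rnorm (T g) < c * r by rewrite ltNge cg.
rewrite -[rnorm _](mulKf (_ : 2 != 0)) ?pnatr_eq0 // ltr_pdivrMl ?ltr0n //.
have -> : 2 * rnorm (T g) = rnorm (T (f + g) - T (f - g)).
  rewrite -linearB opprB addrC addrA subrK linearD -[2]ger0_norm // -rnormZr.
  by rewrite rmorphD rmorph1 scalerDl scale1r.
by rewrite (le_lt_trans (ler_rnormB _ _)) // mulrDl mul1r ltrD.
Qed.

(* Sokal's gliding-hump proof of the uniform boundedness principle. *)
Lemma gliding_hump (T : nat -> {linear E -> E}) :
  (forall n, continuous (T n)) ->
  (forall n, exists f, n.+1%:R * 3 ^+ n * rnorm f < rnorm (T n f)) ->
  exists f, forall n, n%:R <= 4 * rnorm (T n f) :> R.
Proof.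
move=> Tc Tn.
have /choice[K KP] := fun n => linear_opnorm (Tc n).
have KL n : n.+1%:R * 3 ^+ n < K n.
  have [f Tf] := Tn n; have [K0 KT _] := KP n; rewrite ltNge; apply/negP => Kn.
  move: Tf; apply/negP; rewrite -leNgt (le_trans (KT f)) //.
  by rewrite ler_wpM2r // rnorm_ge0.
have K0 n : 0 < K n.
  by rewrite (le_lt_trans _ (KL n)) // mulr_ge0 // exprn_ge0.
(* The limit of the steps will lie within 3^-n / 2 of [x n.+1], costing half of [K n * 3^-1 ^+ n];
   the fraction 3/4, chosen below 1, leaves a quarter. *)
have step (p : nat * E) : exists g, rnorm (g - p.2) <= 3^-1 ^+ p.1 /\
    3 / 4 * K p.1 * 3^-1 ^+ p.1 <= rnorm (T p.1 g).
  have [_ _ KT] := KP p.1; apply: ball_large.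
  - by rewrite exprn_ge0 // invr_ge0.
  - by rewrite mulr_ge0 // ltW.
  - by apply: KT; have := K0 p.1; lra.
have {step}/choice[next nextP] := step.
pose x := fix x n := if n is n'.+1 then next (n', x n') else 0.
have xS n : rnorm (x n.+1 - x n) <= 1 * 3^-1 ^+ n.
  by rewrite mul1r; have [] := nextP (n, x n).
have [|l lP] := geometric_cvg _ xS; first lra.
exists l => n.
have [_ KT _] := KP n; have [_ /= Tx] := nextP (n, x n).
have {}lP : rnorm (x n.+1 - l) <= 2^-1 * 3^-1 ^+ n.
  rewrite rnormBC (le_trans (lP _)) // exprS mulrA (_ : 1 / _ * _ = 2^-1) //.
  by field.
have TB : rnorm (T n (x n.+1)) <= rnorm (T n l) + K n * (2^-1 * 3^-1 ^+ n).
  rewrite -[x n.+1](subrK l) linearD addrC (le_trans (ler_rnormD _ _)) //.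
  by rewrite lerD2l (le_trans (KT _)) // ler_wpM2l // ltW.
have KL' : n.+1%:R <= K n * 3^-1 ^+ n.
  by rewrite exprVn ler_pdivlMr ?exprn_gt0 // ltW.
move: Tx TB KL'; rewrite -[next _]/(x n.+1) -natr1 -mulrA.
lra.
Qed.

End UniformBoundedness.

(** * Local bounds and Riemann sums for semigroups *)

Section Semigroups.
Context {R : realType} {E : completeNormedModType R[i]}.
Implicit Types (f g : E) (S : R -> {linear E -> E}) (G : operator E).

Lemma C0_orbit S f : C0_semigroup S -> forall e, 0 < e ->
  exists2 d, 0 < d & forall t, 0 <= t -> t <= d -> rnorm (S t f - f) <= e.
Proof.
move=> S0 e e0; have [d d0 dP] :=
  (cvg0_rnormP _ _).1 (semigroup_strongly_continuous S0 (f := f)) _ e0.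
exists d => // t; rewrite le_eqVlt => /orP[/eqP<- _|]; last exact: dP.
by rewrite (semigroup0 S0) subrr rnorm0 ltW.
Qed.

(** Otherwise there are times t_n <= 1/(n + 1) at which the operator norm exceeds (n + 1) 3^n. The
    gliding hump then gives an f with S t_n f unbounded, against S t_n f --> f. *)
Lemma C0_bound_near0 S : C0_semigroup S -> exists d M : R,
  [/\ 0 < d, 0 <= M &
      forall t f, 0 <= t -> t <= d -> rnorm (S t f) <= M * rnorm f].
Proof.
move=> S0; apply: contrapT => nS.
have tP n : exists t, (0 <= t <= n.+1%:R^-1) /\
    exists f, n.+1%:R * 3 ^+ n * rnorm f < rnorm (S t f).
  apply: contrapT => nt; apply: nS; exists n.+1%:R^-1, (n.+1%:R * 3 ^+ n).
  split; [by rewrite invr_gt0|by rewrite mulr_ge0 ?exprn_ge0|].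
  move=> t f t0 tn; rewrite leNgt; apply/negP => Sf; apply: nt.
  by exists t; rewrite t0 tn; split => //; exists f.
have [t {}tP] := choice tP.
have [n|n|f fP] := gliding_hump (T := fun n => S (t n)).
- by apply: semigroup_continuous => //; have [/andP[]] := tP n.
- by have [] := tP n.
have [d d0 dP] := C0_orbit f S0 ltr01.
(* Large enough that [t n <= d] and that n exceeds 4 (1 + |f|). *)
pose n := (Num.truncn d^-1 + (Num.truncn (4 * (1 + rnorm f))).+1)%N.
have n1 : d^-1 < n.+1%:R.
  by rewrite (lt_le_trans (truncnS_gt _)) // ler_nat ltnS leq_addr.
have n2 : 4 * (1 + rnorm f) < n%:R.
  by rewrite (lt_le_trans (truncnS_gt _)) // ler_nat leq_addl.
have [/andP[t0 tn] _] := tP n.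
have : rnorm (S (t n) f - f) <= 1.
  apply: dP => //; rewrite (le_trans tn) // -[d]invrK lef_pV2 ?posrE ?invr_gt0 //.
  exact: ltW.
have := ler_rnormD (S (t n) f - f) f; rewrite subrK.
have := fP n; lra.
Qed.

(** The semigroup law carries the bound from [0, d] to [0, n d] by induction on n. *)
Lemma C0_bound S : C0_semigroup S -> forall b : R, exists2 M, 0 <= M &
  forall t f, 0 <= t -> t <= b -> rnorm (S t f) <= M * rnorm f.
Proof.
move=> S0 b; have [d [M [d0 M0 MP]]] := C0_bound_near0 S0.
have bound_mul n : exists2 K, 0 <= K &
    forall t f, 0 <= t -> t <= n%:R * d -> rnorm (S t f) <= K * rnorm f.
  elim: n => [|n [K K0 KP]].
    exists M => // t f t0; rewrite mul0r => t0'; apply: MP => //.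
    by rewrite (le_trans t0') // ltW.
  exists (M + M * K) => [|t f t0 td]; first by rewrite addr_ge0 ?mulr_ge0.
  have [td'|td'] := leP t d.
    rewrite (le_trans (MP _ _ t0 td')) // ler_wpM2r ?rnorm_ge0 //.
    by rewrite lerDl mulr_ge0.
  rewrite -[t](subrKC d) (semigroupD S0) ?subr_ge0 ?(ltW td') ?(ltW d0) //.
  rewrite (le_trans (MP _ _ (ltW d0) (lexx _))) // mulrDl ler_wpDl //.
    by rewrite mulr_ge0 // rnorm_ge0.
  rewrite -mulrA ler_wpM2l // KP ?subr_ge0 ?(ltW td') //.
  by rewrite lerBlDr (le_trans td) // -natr1 mulrDl mul1r.
have [K K0 KP] := bound_mul (Num.truncn (b / d)).+1.
exists K => // t f t0 tb; apply: KP => //; rewrite (le_trans tb) //.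
by rewrite -ler_pdivrMr // ltW // truncnS_gt.
Qed.

Lemma generatorP S G u : generator S G -> op_dom G u ->
  forall e, 0 < e -> exists2 d, 0 < d &
    forall t, 0 < t -> t <= d -> rnorm (S t u - u - t%:C *: G u) <= t * e.
Proof.
move=> SG Du e e0.
have [d d0 dP] := (cvg0_rnormP _ _).1 ((SG u (G u)).1 (conj Du erefl)) _ e0.
exists d => // t t0 td.
have -> : S t u - u - t%:C *: G u =
    t%:C *: ((t^-1)%:C *: (S t u - u) - G u).
  by rewrite scalerBr scalerA -rmorphM /= mulfV ?gt_eqF // scale1r.
by rewrite rnormZr gtr0_norm // ler_wpM2l ?dP // ltW.
Qed.

Lemma semigroup_telescope S (t : R) f n : C0_semigroup S -> 0 <= t ->
  S (n%:R * t) f - f = \sum_(k < n) S (k%:R * t) (S t f - f).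
Proof.
move=> S0 t0; elim: n => [|n ih].
  by rewrite big_ord0 mul0r (semigroup0 S0) subrr.
rewrite big_ord_recr /= -ih linearB addrC -natr1 mulrDl mul1r.
by rewrite (semigroupD S0) ?mulr_ge0 // addrA subrK.
Qed.

(* A Riemann-sum form of S t u - u = \int_0^t S r (G u) dr. *)
Lemma semigroup_riemann S G u : C0_semigroup S -> generator S G -> op_dom G u ->
  forall t e, 0 < t -> 0 < e -> exists2 n, (0 < n)%N &
    rnorm (S t u - u - (t / n%:R)%:C *: \sum_(k < n) S (k%:R * (t / n%:R)) (G u))
      <= e.
Proof.
move=> S0 SG Du t e t0 e0.
have [M M0 MP] := C0_bound S0 t.
(* Each of the n steps of length t/n then errs by at most (e/n) M/(M + 1), after the factor [M] from
   applying the semigroup; the sum is at most e. *)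
have [|d d0 dP] := generatorP SG Du (e := e / (t * (M + 1))).
  by rewrite divr_gt0 // mulr_gt0 // ltr_wpDl.
pose n := (Num.truncn (t / d)).+1; pose h := t / n%:R.
have n0 : 0 < n%:R :> R by [].
have h0 : 0 < h by rewrite divr_gt0.
have hd : h <= d by rewrite ler_pdivrMr // mulrC -ler_pdivrMr // ltW // truncnS_gt.
have tE : t = n%:R * h by rewrite mulrC divfK // gt_eqF.
exists n => //; rewrite -/h {1}tE semigroup_telescope ?(ltW h0) //.
rewrite scaler_sumr -sumrB (le_trans (ler_rnorm_sum _)) //.
have kP (k : 'I_n) : true -> rnorm (S (k%:R * h) (S h u - u) -
    h%:C *: S (k%:R * h) (G u)) <= e / n%:R.
  move=> _; rewrite -linearZ -linearB (le_trans (MP _ _ _ _)) //.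
  - by rewrite mulr_ge0 // ltW.
  - by rewrite [leRHS]tE ler_wpM2r ?(ltW h0) // ler_nat ltnW.
  rewrite (le_trans (ler_wpM2l M0 (dP _ h0 hd))) //.
  rewrite /h (_ : M * _ = e / n%:R * (M / (M + 1))); last first.
    by field; rewrite !gt_eqF // ltr_wpDl.
  rewrite ler_piMr ?divr_ge0 ?(ltW e0) // ler_pdivrMr ?ltr_wpDl //.
  by rewrite mul1r lerDl.
rewrite (le_trans (ler_sum _ kP)) // sumr_const card_ord -[_ *+ n]mulr_natr divfK //.
by rewrite gt_eqF.
Qed.

(** All Riemann sums for S t u - u vanish with G u. *)
Lemma generator0_invariant S G u : C0_semigroup S -> generator S G ->
  op_dom G u -> G u = 0 -> forall t, 0 <= t -> S t u = u.
Proof.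
move=> S0 SG Du Gu0 t; rewrite le_eqVlt => /orP[/eqP<-|t0].
  exact: semigroup0.
apply/eqP; rewrite -subr_eq0; apply/eqP/rnorm_small_eq0 => e e0.
have [n _] := semigroup_riemann S0 SG Du t0 e0.
by rewrite Gu0 big1 ?scaler0 ?subr0 // => k _; rewrite linear0.
Qed.

(** A mean value inequality, read off the Riemann sums. *)
Lemma semigroup_lipschitz S G u (M t : R) : C0_semigroup S -> generator S G ->
  op_dom G u -> 0 < t ->
  (forall r, 0 <= r -> r <= t -> rnorm (S r (G u)) <= M) ->
  rnorm (S t u - u) <= t * M.
Proof.
move=> S0 SG Du t0 MP; apply/ler_addgt0Pr => e e0.
have [n n0] := semigroup_riemann S0 SG Du t0 e0; set w := (_ *: _) => wP.
have {}n0 : 0 < n%:R :> R by rewrite ltr0n.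
have wM : rnorm w <= t * M.
  rewrite rnormZr ger0_norm; last by rewrite divr_ge0 // ltW.
  have kP (k : 'I_n) : true -> rnorm (S (k%:R * (t / n%:R)) (G u)) <= M.
    move=> _; apply: MP; first by rewrite mulr_ge0 // divr_ge0 // ltW.
    by rewrite mulrCA ler_piMr ?(ltW t0) // ler_pdivrMr // mul1r ler_nat ltnW.
  have := le_trans (ler_rnorm_sum _) (ler_sum _ kP).
  rewrite sumr_const card_ord -[_ *+ n]mulr_natr => sM.
  rewrite (le_trans (ler_wpM2l _ sM)) ?divr_ge0 ?(ltW t0) //.
  by rewrite (_ : t / _ * _ = t * M) //; field; rewrite gt_eqF.
by rewrite [leRHS]addrC -[S t u - u](subrK w) (le_trans (ler_rnormD _ _)) // lerD.
Qed.

End Semigroups.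

(** * The orbit integral over [0, 1] and the range of the generator *)

Section OrbitIntegral.
Context {R : realType} {E : completeNormedModType R[i]}.
Variables (S : R -> {linear E -> E}) (S_C0 : C0_semigroup S).
Implicit Types (f g v : E) (h : R).

Definition orbit_sum h n f : E := \sum_(k < n) S (k%:R * h) f.

Lemma orbit_sumD h m n f : 0 <= h ->
  orbit_sum h (m + n) f = orbit_sum h m f + S (m%:R * h) (orbit_sum h n f).
Proof.
move=> h0; rewrite /orbit_sum big_split_ord /= linear_sum; congr (_ + _).
apply: eq_bigr => k _; rewrite -(semigroupD S_C0) ?mulr_ge0 //.
by rewrite -mulrDl natrD.
Qed.

(** Grouping the terms into m blocks of n exhibits a fine sum as a coarse one, which is how a mesh
    is compared with its refinement. *)
Lemma orbit_sumM h m n f : 0 <= h ->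
  orbit_sum h (m * n) f = orbit_sum (n%:R * h) m (orbit_sum h n f).
Proof.
move=> h0; elim: m => [|m ih]; first by rewrite /orbit_sum !big_ord0.
rewrite mulSn addnC orbit_sumD // ih [in RHS]/orbit_sum big_ord_recr /=.
by rewrite natrM mulrA.
Qed.

Lemma orbit_sumB h n f g : orbit_sum h n (f - g) = orbit_sum h n f - orbit_sum h n g.
Proof. by rewrite /orbit_sum -sumrB; apply: eq_bigr => k _; rewrite linearB. Qed.

Lemma orbit_sumZ h n (a : R[i]) f : orbit_sum h n (a *: f) = a *: orbit_sum h n f.
Proof. by rewrite /orbit_sum scaler_sumr; apply: eq_bigr => k _; rewrite linearZ. Qed.

Lemma orbit_sumC h n t f : 0 <= h -> 0 <= t ->
  S t (orbit_sum h n f) = orbit_sum h n (S t f).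
Proof.
move=> h0 t0; rewrite linear_sum; apply: eq_bigr => k _.
by rewrite -!(semigroupD S_C0) ?mulr_ge0 // addrC.
Qed.

Lemma orbit_sum_bound h n f M : 0 <= h ->
  (forall t, 0 <= t -> t <= n%:R * h -> rnorm (S t f) <= M) ->
  rnorm (orbit_sum h n f) <= n%:R * M.
Proof.
move=> h0 MP; rewrite (le_trans (ler_rnorm_sum _)) //.
rewrite (le_trans (ler_sum _ (G := fun=> M) _)) //.
  by move=> k _; apply: MP; rewrite ?mulr_ge0 // ler_wpM2r // ler_nat ltnW.
by rewrite sumr_const card_ord -[_ *+ n]mulr_natl.
Qed.

Lemma orbit_sum_near h n f e : 0 <= h ->
  (forall t, 0 <= t -> t <= n%:R * h -> rnorm (S t f - f) <= e) ->
  rnorm (orbit_sum h n f - n%:R%:C *: f) <= n%:R * e.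
Proof.
move=> h0 MP; have -> : n%:R%:C *: f = \sum_(k < n) f.
  by rewrite sumr_const card_ord rmorph_nat scaler_nat.
rewrite -sumrB (le_trans (ler_rnorm_sum _)) //.
rewrite (le_trans (ler_sum _ (G := fun=> e) _)) //.
  by move=> k _; apply: MP; rewrite ?mulr_ge0 // ler_wpM2r // ler_nat ltnW.
by rewrite sumr_const card_ord -[_ *+ n]mulr_natl.
Qed.

(* Riemann sum of \int_0^1 S t f dt with step 1/n *)
Definition orbit_mean n f : E := (n%:R^-1)%:C *: orbit_sum n%:R^-1 n f.

Lemma natC_mulVf n : (0 < n)%N -> (n%:R^-1)%:C * n%:R%:C = 1 :> R[i].
Proof. by move=> n0; rewrite -rmorphM mulVf ?rmorph1 // pnatr_eq0 -lt0n. Qed.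

(** The difference is the coarse mean of [w], the average of S t f - f over the n fine grid points
    of one cell; [w] has norm at most e. *)
Lemma orbit_mean_refine M m n f e : (0 < m)%N -> (0 < n)%N -> 0 <= M ->
  (forall t g, 0 <= t -> t <= 1 -> rnorm (S t g) <= M * rnorm g) ->
  (forall t, 0 <= t -> t <= m%:R^-1 -> rnorm (S t f - f) <= e) ->
  rnorm (orbit_mean (m * n) f - orbit_mean m f) <= M * e.
Proof.
move=> m0 n0 M0 MP eP.
have m0R : m%:R != 0 :> R by rewrite pnatr_eq0 -lt0n.
have n0R : n%:R != 0 :> R by rewrite pnatr_eq0 -lt0n.
have mn0 : (m * n)%:R^-1 >= 0 :> R by rewrite invr_ge0.
have nmn : n%:R * (m * n)%:R^-1 = m%:R^-1 :> R.
  by rewrite natrM invfM mulrCA divff // mulr1.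
rewrite /orbit_mean orbit_sumM // nmn.
have -> : ((m * n)%:R^-1)%:C = (m%:R^-1)%:C * (n%:R^-1)%:C :> R[i].
  by rewrite natrM invfM rmorphM.
rewrite -scalerA -orbit_sumZ -scalerBr -orbit_sumB rnormZr ger0_norm ?invr_ge0 //.
rewrite ler_pdivrMl ?lt_def ?m0R ?ler0n //.
set w := _ - f; have we : rnorm w <= e.
  have -> : w = (n%:R^-1)%:C *: (orbit_sum (m * n)%:R^-1 n f - n%:R%:C *: f).
    by rewrite scalerBr scalerA natC_mulVf // scale1r.
  rewrite rnormZr ger0_norm ?invr_ge0 // ler_pdivrMl ?lt_def ?n0R ?ler0n //.
  by apply: orbit_sum_near => // t t0; rewrite nmn; exact: eP.
apply: orbit_sum_bound; first by rewrite invr_ge0.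
move=> t t0; rewrite divff // => t1.
by rewrite (le_trans (MP _ _ t0 t1)) // ler_wpM2l.
Qed.

(** Cauchy property: two means are compared through their common refinement. *)
Lemma orbit_mean_cvg f : exists v, forall e : R, 0 < e ->
  exists N, forall n, (N <= n)%N -> rnorm (orbit_mean n.+1 f - v) <= e.
Proof.
have [M M0 MP] := C0_bound S_C0 1.
apply: rnorm_cauchy => e e0.
have [|d d0 dP] := C0_orbit f S_C0 (e := e / (2 * (M + 1))).
  by rewrite divr_gt0 // mulr_gt0 // ltr_wpDl.
have nP n : (Num.truncn d^-1 <= n)%N -> n.+1%:R^-1 <= d.
  move=> nd; rewrite -[d]invrK lef_pV2 ?posrE ?invr_gt0 //.
  by rewrite ltW // (lt_le_trans (truncnS_gt _)) // ler_nat.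
exists (Num.truncn d^-1) => n nd; set m := Num.truncn _ in nd *.
pose e1 := e / (2 * (M + 1)).
have l1 : rnorm (orbit_mean (n.+1 * m.+1) f - orbit_mean n.+1 f) <= M * e1.
  apply: orbit_mean_refine => // t t0 tn; apply: dP => //.
  exact: le_trans (nP _ nd).
have l2 : rnorm (orbit_mean (n.+1 * m.+1) f - orbit_mean m.+1 f) <= M * e1.
  rewrite mulnC; apply: orbit_mean_refine => // t t0 tn; apply: dP => //.
  exact: le_trans (nP _ (leqnn _)).
rewrite (le_trans (ler_rnorm_dist (orbit_mean (n.+1 * m.+1) f) _ _)) //.
rewrite rnormBC (le_trans (lerD l1 l2)) //.
have M1 : 0 < M + 1 by rewrite ltr_wpDl.
rewrite /e1 (_ : _ + _ = e * (M / (M + 1))); last by field; rewrite gt_eqF.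
by rewrite ler_piMr ?(ltW e0) // ler_pdivrMr // mul1r lerDl.
Qed.

(** Discrete form of S s J - J = \int_0^s S r (S 1 f - f) dr for J = \int_0^1 S r f dr, at the grid
    time s = j/n. *)
Lemma orbit_mean_shift n j f e : (0 < n)%N ->
  (forall t, 0 <= t -> t <= j%:R / n%:R ->
     rnorm (S t (S 1 f - f) - (S 1 f - f)) <= e) ->
  rnorm (S (j%:R / n%:R) (orbit_mean n f) - orbit_mean n f
         - (j%:R / n%:R)%:C *: (S 1 f - f)) <= j%:R / n%:R * e.
Proof.
move=> n0 eP; set g := S 1 f - f in eP *.
have n0R : n%:R != 0 :> R by rewrite pnatr_eq0 -lt0n.
have nV0 : 0 <= n%:R^-1 :> R by rewrite invr_ge0.
have -> : S (j%:R / n%:R) (orbit_mean n f) - orbit_mean n f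
    - (j%:R / n%:R)%:C *: g =
    (n%:R^-1)%:C *: (orbit_sum n%:R^-1 j g - j%:R%:C *: g).
  have -> : (j%:R / n%:R)%:C = (n%:R^-1)%:C * j%:R%:C :> R[i].
    by rewrite mulrC rmorphM.
  rewrite /orbit_mean linearZ /= -scalerBr -scalerA -scalerBr.
  congr (_ *: (_ - _)); rewrite /g orbit_sumB -(orbit_sumC _ _ nV0) //.
  (* The sum over n + j terms is split in both orders, after n terms and after j terms. *)
  have := orbit_sumD n j f nV0; rewrite addnC orbit_sumD // divff // => sumE.
  set B := orbit_sum n%:R^-1 n f in sumE *; apply: (addrI B).
  by rewrite [LHS]addrC subrK addrA -sumE [RHS]addrC addKr.
rewrite rnormZr ger0_norm // mulrAC [leRHS]mulrC ler_wpM2l //.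
exact: orbit_sum_near.
Qed.

(** The witness is v = \int_0^1 S t f dt, the limit of the means; its difference quotients come from
    the shift formula. *)
Lemma range_generator G f : generator S G ->
  exists v, op_dom G v /\ G v = S 1 f - f.
Proof.
move=> SG; have [v vP] := orbit_mean_cvg f; set g := S 1 f - f.
have [M M0 MP] := C0_bound S_C0 1.
exists v; apply/SG/cvg0_rnormP => e e0.
have [d d0 dP] := C0_orbit g S_C0 e0.
exists (Num.min d 1) => [|t t0]; first by rewrite lt_min d0 ltr01.
rewrite le_min => /andP[td t1].
suff : rnorm (S t v - v - t%:C *: g) <= t * e.
  have -> : S t v - v - t%:C *: g = t%:C *: ((t^-1)%:C *: (S t v - v) - g).
    by rewrite [RHS]scalerBr scalerA -rmorphM /= mulfV ?gt_eqF // scale1r.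
  by rewrite rnormZr gtr0_norm // ler_pM2l.
apply/ler_addgt0Pr => e' e'0.
(* [C] collects the errors [l1], [l2] and [l4] below, which are M x, M x + x and x |g|. *)
pose C := 2 * M + 1 + rnorm g.
have C0 : 0 < C by rewrite /C -addrA ltr_wpDl ?mulr_ge0 // ltr_pwDl ?rnorm_ge0.
pose x := e' / C; have x0 : 0 < x by rewrite divr_gt0.
have [N NP] := vP _ x0.
have [d' d'0 d'P] := C0_orbit v S_C0 x0.
pose n := (N + Num.truncn d'^-1 + Num.truncn x^-1)%N.
have nV (r : R) : 0 < r -> (Num.truncn r^-1 <= n)%N -> n.+1%:R^-1 <= r.
  move=> r0 rn; rewrite -[r]invrK lef_pV2 ?posrE ?invr_gt0 //.
  by rewrite ltW // (lt_le_trans (truncnS_gt _)) // ler_nat.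
have nd' : n.+1%:R^-1 <= d' by apply: nV; rewrite // /n -addnA addnCA leq_addr.
have nx : n.+1%:R^-1 <= x by apply: nV; rewrite // /n leq_addl.
have n0 : 0 < n.+1%:R :> R by [].
set V := orbit_mean n.+1 f.
have {vP NP}Vv : rnorm (V - v) <= x by apply: NP; rewrite /n -addnA leq_addr.
(* The shift formula holds at grid times only, so t is rounded down to the grid point [s]. *)
pose j := Num.truncn (t * n.+1%:R); pose s : R := j%:R / n.+1%:R.
have s0 : 0 <= s by rewrite divr_ge0.
have st : s <= t by rewrite ler_pdivrMr // truncn_le // mulr_ge0 // ltW.
have tsn : t - s <= n.+1%:R^-1.
  rewrite lerBlDl -(ler_pM2r n0) mulrDl mulVf ?divfK ?gt_eqF //.
  by rewrite natr1 ltW // truncnS_gt.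
have s1 : s <= 1 by exact: le_trans t1.
(* The four terms account for rounding t in the orbit, replacing v by the mean V, shifting V, and
   rounding t in t g. *)
have -> : S t v - v - t%:C *: g = S s (S (t - s) v - v) +
    ((S s (v - V) - (v - V)) + (S s V - V - s%:C *: g) + (s - t)%:C *: g).
  have -> : S s (S (t - s) v - v) = S t v - S s v.
    by rewrite linearB -(semigroupD S_C0) ?subr_ge0 // subrKC.
  have -> : (s - t)%:C *: g = s%:C *: g - t%:C *: g.
    by rewrite rmorphB scalerBl.
  have -> : S s (v - V) = S s v - S s V by rewrite linearB.
  rewrite (_ : S s v - S s V - (v - V) = S s v - v - (S s V - V)); last first.
    by rewrite opprD addrACA -opprD.
  rewrite (subrKA (S s V - V)) (subrKA (s%:C *: g)) -(addrA (S s v)) subrKA.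
  by rewrite addrA.
have l1 : rnorm (S s (S (t - s) v - v)) <= M * x.
  rewrite (le_trans (MP _ _ s0 s1)) // ler_wpM2l // d'P ?subr_ge0 //.
  exact: le_trans nd'.
have l2 : rnorm (S s (v - V) - (v - V)) <= M * x + x.
  rewrite (le_trans (ler_rnormB _ _)) // lerD //; last by rewrite rnormBC.
  by rewrite (le_trans (MP _ _ s0 s1)) // ler_wpM2l // rnormBC.
have l3 : rnorm (S s V - V - s%:C *: g) <= s * e.
  apply: orbit_mean_shift => // r r0 rs; apply: dP => //.
  by rewrite (le_trans rs) // (le_trans st).
have l4 : rnorm ((s - t)%:C *: g) <= x * rnorm g.
  rewrite rnormZr distrC ger0_norm ?subr_ge0 // ler_wpM2r ?rnorm_ge0 //.
  exact: le_trans nx.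
have se : s * e <= t * e by rewrite ler_wpM2r // ltW.
have e'E : e' = x * C by rewrite divfK // gt_eqF.
rewrite (le_trans (ler_rnormD _ _)) // (le_trans (lerD l1 (ler_rnormD _ _))) //.
have := le_trans (ler_rnormD _ _) (lerD l2 l3) => l23.
rewrite (le_trans (lerD (lexx _) (lerD l23 l4))) // e'E /C.
by rewrite -subr_ge0 (_ : _ - _ = t * e - s * e) ?subr_ge0 //; ring.
Qed.

End OrbitIntegral.

(** * Rescaled semigroups and a half-plane of resolvent points *)

Section Resolvent.
Context {R : realType} {E : completeNormedModType R[i]}.
Implicit Types (S : R -> {linear E -> E}) (G : operator E) (f g u : E).
Implicit Types (z : R[i]).

Definition rescale z S : R -> {linear E -> E} := fun t => cexp z t \*: S t.

Lemma rescaleE z S t f : rescale z S t f = cexp z t *: S t f.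
Proof. by []. Qed.

Lemma rnorm_rescale z S t f :
  rnorm (rescale z S t f) = expR (t * complex.Re z) * rnorm (S t f).
Proof. by rewrite rescaleE rnormZ norm_cexp. Qed.

Lemma rescale_C0 z S : C0_semigroup S -> C0_semigroup (rescale z S).
Proof.
move=> S0; split => [t t0 f|f|s t f s0 t0|f].
- apply: cvgZl_tmp; exact: semigroup_continuous.
- by rewrite rescaleE cexp0 scale1r (semigroup0 S0).
- by rewrite !rescaleE (semigroupD S0) // linearZ scalerA cexpD.
- rewrite -[X in _ --> X]scale1r; apply: cvgZ; first exact: cvg_cexp.
  exact: semigroup_strongly_continuous.
Qed.

(** Product rule: the quotient is ((e^{tz} - 1)/t) f + e^{tz} (S t f - f)/t. *)
Lemma rescale_cvg z S f g :
  (t^-1)%:C *: (S t f - f) @[t --> 0^'+] --> g ->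
  (t^-1)%:C *: (rescale z S t f - f) @[t --> 0^'+] --> z *: f + g.
Proof.
move=> Sg; rewrite -[g]scale1r.
have -> : (fun t => (t^-1)%:C *: (rescale z S t f - f)) =
    (fun t => ((t^-1)%:C * (cexp z t - 1)) *: f +
              cexp z t *: ((t^-1)%:C *: (S t f - f))).
  apply/funext => t; rewrite rescaleE; move: (cexp z t) => k.
  rewrite -scalerA [k *: (_ *: _)]scalerA [k * _]mulrC -scalerA -scalerDr; congr (_ *: _).
  by rewrite scalerBl scale1r scalerBr [RHS]addrC subrKA.
apply: cvgD; first by apply: cvgZr_tmp; exact: cexp_derive.
by apply: cvgZ => //; exact: cvg_cexp.
Qed.

Lemma rescale_generator z S G : generator S G ->
  generator (rescale z S) (shift_op z G).
Proof.
move=> SG f g; split=> [[Df <-]|]; first by apply/rescale_cvg/SG.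
(* The converse is obtained by rescaling back with -z. *)
move=> /(@rescale_cvg (- z) _ _ _).
have -> : (fun t => (t^-1)%:C *: (rescale (- z) (rescale z S) t f - f)) =
    (fun t => (t^-1)%:C *: (S t f - f)).
  by apply/funext => t; rewrite !rescaleE scalerA cexpK scale1r.
move=> /SG[Df Gf]; split => //=.
by rewrite Gf scaleNr addNKr.
Qed.

(* Since (z - G) v = f - e^{-z} S 1 f can be solved for every f, inverting
   I - e^{-z} S 1 by a Neumann series solves the resolvent equation. *)
Lemma resolvent_half_plane S G : C0_semigroup S -> generator S G ->
  exists M, forall z, M < complex.Re z -> resolvent_set G z.
Proof.
move=> S0 SG; have [M M0 MP] := C0_bound S0 1; exists M => z Mz.
pose U := rescale (- z) S.
have U0 : C0_semigroup U by exact: rescale_C0.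
have UG : generator U (shift_op (- z) G) by exact: rescale_generator.
pose q := expR (- complex.Re z) * M.
(* From M < Re z and 1 + Re z <= e^{Re z}. *)
have q01 : 0 <= q < 1.
  rewrite mulr_ge0 ?expR_ge0 //= /q expRN mulrC ltr_pdivrMr ?expR_gt0 // mul1r.
  rewrite (lt_le_trans Mz) // (le_trans _ (expR_ge1Dx _)) //; lra.
have Uq f : rnorm (U 1 f) <= q * rnorm f.
  rewrite rnorm_rescale mul1r [X in expR X](_ : _ = - complex.Re z); last by case: (z).
  by rewrite -mulrA ler_wpM2l ?expR_ge0 // MP.
have [M' M'0 M'P] := C0_bound U0 1.
have zE u : z *: u - G u = - ((- z) *: u + G u) by rewrite opprD scaleNr opprK.
(* |u| <= |U 1 u| + |U 1 u - u| <= q |u| + M' |z u - G u|. This bounds the inverse and also gives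
   uniqueness below. *)
have bnd u : op_dom G u ->
    rnorm u <= (1 - q)^-1 * M' * rnorm (z *: u - G u).
  move=> Du; have := @semigroup_lipschitz _ _ _ _ u (M' * rnorm (z *: u - G u)) 1
    U0 UG Du ltr01; rewrite mul1r => UL.
  have {}UL : rnorm (U 1 u - u) <= M' * rnorm (z *: u - G u).
    apply: UL => r r0 r1; rewrite zE rnormN; exact: M'P.
  have := ler_rnorm_dist (U 1 u) u 0; rewrite !subr0 rnormBC => d1.
  rewrite -mulrA ler_pdivlMl; last lra.
  by have := Uq u; lra.
split=> [f|]; last first.
  exists ((1 - q)^-1 * M') => u Du; rewrite -!rnormE -rmorphM lecR; exact: bnd.
have [w wf] := contraction_surj q01 Uq f.
have [v [Dv vP]] := range_generator U0 w UG.
have {}vP : z *: v - G v = f.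
  by rewrite zE -[_ + _]/(shift_op (- z) G v) vP opprB.
exists v; split; first by split.
move=> v' /= [Dv' v'P]; apply/eqP; rewrite -subr_eq0 addrC -scaleN1r.
set d := _ + v; have Dd : op_dom G d by exact: op_domP.
have d0 : z *: d - G d = 0.
  have := op_linear (o := shift_op z (opp_op G)) (-1) Dv' Dv => /= ->.
  by rewrite v'P vP scaleN1r addNr.
apply/eqP/rnorm0_eq0/eqP; rewrite eq_le rnorm_ge0 andbT.
by rewrite (le_trans (bnd _ Dd)) // d0 rnorm0 mulr0.
Qed.

End Resolvent.

(** * Positivity of the resolvent *)

Lemma subrACA (V : zmodType) (x y z w : V) : x - y - (z - w) = x - z - (y - w).
Proof. by rewrite opprD addrACA -opprD. Qed.

Section PositiveResolvent.
Context {R : realType} {E : complexBanachLatticeType R}.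
Implicit Types (S : R -> {linear E -> E}) (G : operator E) (f g u : E).
Implicit Types (m n : R).

Lemma inv_opP (T : operator E) f : (exists u, op_dom T u /\ T u = f) ->
  op_dom T (inv_op T f) /\ T (inv_op T f) = f.
Proof. exact: xgetPex. Qed.

Lemma resolvent_setP G (z : R[i]) : resolvent_set G z ->
  exists2 M : R, 0 <= M &
    (forall f, exists u, op_dom G u /\ z *: u - G u = f) /\
    (forall u, op_dom G u -> rnorm u <= M * rnorm (z *: u - G u)).
Proof.
move=> [Gex [M MP]]; exists `|M| => //; split=> [f|u Du].
  by have [u [uP _]] := Gex f; exists u.
rewrite (@le_trans _ _ (M * rnorm (z *: u - G u))) //.
  by rewrite -lecR rmorphM /= !rnormE; exact: MP.
by rewrite ler_wpM2r ?rnorm_ge0 // ler_norm.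
Qed.

Lemma op_domB G f g : op_dom G f -> op_dom G g -> op_dom G (f - g).
Proof. by move=> Df Dg; rewrite addrC -scaleN1r; exact: op_domP. Qed.

Lemma op_funB G f g : op_dom G f -> op_dom G g -> G (f - g) = G f - G g.
Proof. by move=> Df Dg; rewrite addrC -scaleN1r op_linear // scaleN1r addrC. Qed.

Lemma resolvent_opB G (z : R[i]) u v : op_dom G u -> op_dom G v ->
  z *: (u - v) - G (u - v) = (z *: u - G u) - (z *: v - G v).
Proof. by move=> Du Dv; rewrite op_funB // scalerBr subrACA. Qed.

Lemma op_domZ G (a : R[i]) f : op_dom G f -> op_dom G (a *: f).
Proof. by move=> Df; rewrite -[a *: f]addr0; exact/op_domP/op_dom0. Qed.

Lemma op_fun0 G : G 0 = 0.
Proof. by rewrite -[X in G X](subrr 0) op_funB ?subrr //; exact: op_dom0. Qed.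

Lemma op_funZ G (a : R[i]) f : op_dom G f -> G (a *: f) = a *: G f.
Proof.
by move=> Df; rewrite -[a *: f]addr0 op_linear ?op_fun0 ?addr0 //; exact: op_dom0.
Qed.

(* Together with surjectivity of m - G, this says that (m - G)^-1 >= 0. *)
Definition resolvent_pos G m :=
  forall u, op_dom G u -> Epos (m%:C *: u - G u) -> Epos u.

(** u - P^N u is the sum of the positive elements P^k (u - P u) for k < N, and P^N u tends to 0; the
    cone is closed. *)
Lemma contraction_Epos (P : E -> E) (q : R) u : 0 <= q < 1 ->
  (forall f g, P (f - g) = P f - P g) ->
  (forall f, Epos f -> Epos (P f)) ->
  (forall f, rnorm (P f) <= q * rnorm f) ->
  Epos (u - P u) -> Epos u.
Proof.
move=> /[dup] q01 /andP[q0 q1] PB P0 Pq uPu; apply: Epos_closed => e e0.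
have iterP k : Epos (u - iter k P u) /\ rnorm (iter k P u) <= rnorm u * q ^+ k.
  elim: k => [|k [ih1 ih2]] /=.
    by rewrite subrr mulr1; split => //; exact: Epos0.
  split; last by rewrite (le_trans (Pq _)) // exprS mulrCA ler_wpM2l.
  by rewrite -(subrKA (P u)) -PB; exact/EposD/P0.
have [N Ne] := geometric_small (rnorm u) q01 e0.
exists (u - iter N P u); first by have [] := iterP N.
by rewrite opprB addrC subrK (le_trans _ Ne) //; have [] := iterP N.
Qed.

(** For U t = e^{-mt} S t, u - U 1 u is a limit of Riemann sums of U r (m u - G u), hence positive,
    and U 1 is a positive strict contraction for large m. *)
Lemma resolvent_pos_large S G :
  C0_semigroup S -> generator S G -> positive_semigroup S ->
  exists m0, forall m, m0 < m -> resolvent_pos G m.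
Proof.
move=> S0 SG Spos; have [M M0 MP] := C0_bound S0 1; exists M => m Mm u Du mu.
pose U := rescale (- m)%:C S.
have U0 : C0_semigroup U by exact: rescale_C0.
have UG : generator U (shift_op (- m)%:C G) by exact: rescale_generator.
have Upos : positive_semigroup U.
  move=> t f t0 f0; rewrite /U rescaleE cexp_real; apply: EposZ (Spos _ _ t0 f0).
  exact: expR_ge0.
have q01 : 0 <= expR (- m) * M < 1.
  rewrite mulr_ge0 ?expR_ge0 //= expRN mulrC ltr_pdivrMr ?expR_gt0 // mul1r.
  rewrite (lt_le_trans Mm) // (le_trans _ (expR_ge1Dx _)) //; lra.
apply: (contraction_Epos q01) (linearB (U 1)) _ _ _.
- by move=> f; exact: Upos.
- by move=> f; rewrite rnorm_rescale mul1r -mulrA ler_wpM2l ?expR_ge0 // MP.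
apply: Epos_closed => e e0.
have [n n0] := semigroup_riemann U0 UG Du ltr01 e0.
set w := (_ *: _) => wP; exists (- w); last by rewrite opprK -rnormN opprD opprB.
rewrite -scalerN -sumrN; apply: EposZ; first by rewrite divr_ge0.
apply: Epos_sum => k; rewrite -linearN; apply: Upos.
  by rewrite mulr_ge0 // divr_ge0.
by rewrite /= opprD rmorphN scaleNr opprK.
Qed.

(** With V = (m - G)^-1 >= 0, (n - G) u >= 0 gives u - (m - n) V u = V ((n - G) u) >= 0, and (m - n)
    V is a strict contraction for n near m. *)
Lemma resolvent_pos_left G m : resolvent_set G m%:C -> resolvent_pos G m ->
  exists2 r, 0 < r & forall n, m - r < n -> n <= m -> resolvent_pos G n.
Proof.
move=> /resolvent_setP[M M0 [Gex GM]] Gm; have [V VP] := choice Gex.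
have VE u : op_dom G u -> V (m%:C *: u - G u) = u.
  move=> Du; have [DV VG] := VP (m%:C *: u - G u).
  apply/eqP; rewrite -subr_eq0; apply/eqP/rnorm0_eq0/eqP.
  rewrite eq_le rnorm_ge0 andbT (le_trans (GM _ (op_domB DV Du))) //.
  by rewrite resolvent_opB // VG subrr rnorm0 mulr0.
have VB f g : V (f - g) = V f - V g.
  have [Df Vf] := VP f; have [Dg Vg] := VP g.
  rewrite -[RHS]VE; last exact: op_domB.
  by rewrite resolvent_opB // Vf Vg.
have M1 : 0 < M + 1 by rewrite ltr_wpDl.
exists (M + 1)^-1 => [|n mn nm u Du nu]; first by rewrite invr_gt0.
have h0 : 0 <= m - n by rewrite subr_ge0.
have V0 f : Epos f -> Epos (V f).
  by move=> f0; have [DV VG] := VP f; apply: Gm => //; rewrite VG.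
apply: (@contraction_Epos (fun f => V ((m - n)%:C *: f)) ((m - n) * M)).
- rewrite mulr_ge0 //= (@le_lt_trans _ _ ((m - n) * (M + 1))) //.
    by rewrite ler_wpM2l // lerDl.
  by rewrite -ltr_pdivlMr // div1r ltrBlDl -ltrBlDr.
- by move=> f g; rewrite scalerBr VB.
- by move=> f f0; exact/V0/EposZ.
- move=> f; have [DV VG] := VP ((m - n)%:C *: f).
  by rewrite (le_trans (GM _ DV)) // VG rnormZr ger0_norm // mulrCA mulrA.
rewrite -{1}(VE u Du) -VB; apply: V0.
by rewrite rmorphB scalerBl opprB addrC subrKA.
Qed.

(** As n decreases to m, the positive elements v = (n - G)^-1 (m - G) u approach u. *)
Lemma resolvent_pos_right G m : resolvent_set G m%:C ->
  (forall e, 0 < e -> exists n, [/\ m <= n, n < m + e,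
     resolvent_set G n%:C & resolvent_pos G n]) ->
  resolvent_pos G m.
Proof.
move=> /resolvent_setP[M M0 [_ GM]] mP u Du mu; apply: Epos_closed => e e0.
pose K := 2 * (M + 1) * (rnorm u + 1).
have M1 : 0 < M + 1 by rewrite ltr_wpDl.
have u1 : 0 < rnorm u + 1 by rewrite ltr_wpDl ?rnorm_ge0.
have [|n [mn nm /resolvent_setP[_ _ [Gex _]] Gn]] :=
    mP (Num.min (2 * (M + 1))^-1 (e / K)).
  by rewrite lt_min invr_gt0 divr_gt0 ?mulr_gt0.
have [v [Dv vP]] := Gex (m%:C *: u - G u).
exists v; first by apply: Gn => //; rewrite vP.
rewrite rnormBC; pose h := n - m.
have h0 : 0 <= h by rewrite subr_ge0.
have [h1 h2] : h < (2 * (M + 1))^-1 /\ h < e / K.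
  by apply/andP; rewrite -lt_min ltrBlDl.
have d1 : rnorm (v - u) <= M * (h * rnorm v).
  rewrite (le_trans (GM _ (op_domB Dv Du))) // ler_wpM2l // -[h]ger0_norm //.
  by rewrite resolvent_opB // -vP opprB subrKA -scalerBl -rmorphB rnormZr distrC.
have d2 : rnorm v <= rnorm (v - u) + rnorm u.
  by rewrite -[v in leLHS](subrK u) ler_rnormD.
(* This lets the part of M h |v| coming from |v - u| be absorbed into the left-hand side. *)
have Mh : M * h <= 2^-1.
  by move: h1; rewrite -[_^-1]div1r ltr_pdivlMr ?mulr_gt0 //; lra.
have d3 : rnorm (v - u) <= 2 * (M * h) * rnorm u.
  have := ler_wpM2l (mulr_ge0 M0 h0) d2.
  have := ler_wpM2r (rnorm_ge0 (v - u)) Mh; lra.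
have h3 : h * K <= e by rewrite -ler_pdivlMr ?mulr_gt0 // ltW.
rewrite (le_trans d3) // (le_trans _ h3) // /K.
have := mulr_ge0 h0 M0; have := mulr_ge0 h0 (rnorm_ge0 u); lra.
Qed.

(** Continuation along the real axis: positivity passes to the infimum of [A] from the right, and an
    infimum above m could be lowered by the expansion to the left. *)
Lemma resolvent_pos_down G m m0 :
  (forall n, m <= n -> resolvent_set G n%:C) ->
  (forall n, m0 < n -> resolvent_pos G n) -> resolvent_pos G m.
Proof.
move=> Gres G0; pose A := [set a : R | m <= a /\ forall n, a <= n -> resolvent_pos G n].
have A0 : A !=set0.
  exists (Num.max m (m0 + 1)); split; first by rewrite le_max lexx.
  by move=> n; rewrite ge_max => /andP[_ n0]; apply: G0; rewrite (lt_le_trans _ n0) ?ltrDl.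
have infA : has_inf A by split => //; exists m => a [].
have mA : m <= inf A by apply: lb_le_inf => // a [].
have Ainf n : inf A < n -> resolvent_pos G n.
  move=> An; have nA : 0 < n - inf A by rewrite subr_gt0.
  by have [a [_ aP]] := inf_adherent nA infA; rewrite subrKC => /ltW/aP.
have Ginf : resolvent_pos G (inf A).
  apply: resolvent_pos_right => [|e e0]; first exact: Gres.
  exists (inf A + e / 2); have e20 : 0 < e / 2 by rewrite divr_gt0.
  split; [by rewrite lerDl ltW|by rewrite ltrD2l; lra| |].
    by apply: Gres; rewrite (le_trans mA) // lerDl ltW.
  by apply: Ainf; rewrite ltrDl.
move: mA; rewrite le_eqVlt => /orP[/eqP->//|mA].
have [r r0 rP] := resolvent_pos_left (Gres _ (ltW mA)) Ginf.
(* The right-hand side belongs to [A], yet lies strictly below its infimum. *)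
suff : inf A <= Num.max m (inf A - r / 2).
  rewrite le_max leNgt mA /= lerBrDl gerDr leNgt divr_gt0 //.
apply: ge_inf; first exact: infA.2.
split=> [|n]; first by rewrite le_max lexx.
rewrite ge_max => /andP[_ nr]; have [nA|/Ainf//] := leP n (inf A).
by apply: rP => //; rewrite (lt_le_trans _ nr) // ltrD2l ltrN2; lra.
Qed.

Lemma generator_commute S G t u : C0_semigroup S -> generator S G -> 0 <= t ->
  op_dom G u -> op_dom G (S t u) /\ G (S t u) = S t (G u).
Proof.
move=> S0 SG t0 Du; apply/SG.
have Gu := (SG u (G u)).1 (conj Du erefl).
have : S t ((r^-1)%:C *: (S r u - u)) @[r --> 0^'+] --> S t (G u).
  by apply: cvg_comp Gu _; exact: semigroup_continuous.
apply: cvg_trans; apply: near_eq_cvg; near=> r.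
have r0 : 0 <= r by near: r; exact: nbhs_right_ge.
by rewrite linearZ linearB /= -!(semigroupD S0) // (addrC t r).
Unshelve. all: by end_near. Qed.

(* With u = (n - G)^-1 f, the difference n u - f = G u is the limit of
   (S t u - u)/t = (n - G)^-1 (S t f - f)/t. *)
Lemma resolvent_superinvariant S G n f u :
  C0_semigroup S -> generator S G -> resolvent_pos G n ->
  (forall t, 0 < t -> f <=E S t f) ->
  op_dom G u -> n%:C *: u - G u = f -> f <=E n%:C *: u.
Proof.
move=> S0 SG Gn fS Du uf.
rewrite /cone_le -uf opprB addrC subrK; apply: Epos_closed => e e0.
have [d d0 dP] := generatorP SG Du e0.
have := (SG u (G u)).1 (conj Du erefl) => /cvg0_rnormP /(_ _ e0)[d' d'0 d'P].
exists ((d'^-1)%:C *: (S d' u - u)); last by rewrite rnormBC d'P.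
apply: EposZ; first by rewrite invr_ge0 ltW.
have [DS GS] := generator_commute S0 SG (ltW d'0) Du.
apply: Gn; first exact: op_domB.
rewrite op_funB // GS scalerBr.
have -> : n%:C *: S d' u - n%:C *: u - (S d' (G u) - G u) = S d' f - f.
  by rewrite subrACA -uf (linearB (S d')) linearZ.
exact: fS.
Qed.

End PositiveResolvent.

(** * Domination, eigenvectors and the resolvent estimate *)

Section EigenvectorBounds.
Context {R : realType} {E : complexBanachLatticeType R}.
Implicit Types (S T : R -> {linear E -> E}) (A B : operator E) (f u : E).

(** A real g is the difference of the positive elements |g| and |g| - g, so P maps real vectors to
    real vectors; the decomposition of f does the rest. *)
Lemma positive_reE (P : {linear E -> E}) : (forall f, Epos f -> Epos (P f)) ->
  forall f, reE (P f) = P (reE f).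
Proof.
move=> P0; have Preal g : reE g = g -> reE (P g) = P g.
  move=> rg; have g0 : Epos (modulus g - g).
    by rewrite -{2}rg; exact: reE_le_modulus.
  rewrite -[g in P g](subKr (modulus g)) linearB reEB !Epos_reE //.
  - exact: P0.
  - exact/P0/modulus_ge0.
move=> f; rewrite {1}[f]reE_decomp linearD linearZ reED Preal ?reEK //.
by rewrite reE_i ?addr0 // Preal // reEK.
Qed.

(** Applying S t to [reE (c *: f) <=E modulus f] bounds every rotation of S t f; this is what
    permits A = B. *)
Lemma positive_dominated S : positive_semigroup S -> dominated S S.
Proof.
move=> Spos t f t0; have S0 g : Epos g -> Epos (S t g) by exact: Spos.
apply: modulus_least => c c1; rewrite -linearZ positive_reE // /cone_le -linearB.
exact/S0/modulus_ub.
Qed.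

Lemma dominated_positive S T : dominated S T -> positive_semigroup T.
Proof.
move=> ST t f t0 f0; have := ST t f t0; rewrite (modulus_pos f0).
exact/Epos_le/modulus_ge0.
Qed.

Lemma spectral_bound_resolvent (G : operator E) (z : R[i]) :
  (spectral_bound G < (complex.Re z)%:E)%E -> resolvent_set G z.
Proof.
move=> Gz; apply: contrapT => nz; move: Gz; rewrite ltNge => /negP; apply.
by apply: ereal_sup_ubound; exists z.
Qed.

(** The lower bound of a resolvent point would force phi = 0. It yields -Re lambda <= s(-A). *)
Lemma eigenvalue_spectrum A (lambda : R[i]) (phi : E) :
  eigenpair A lambda phi -> spectrum (opp_op A) (- lambda).
Proof.
move=> [/eqP phi0 Dphi Aphi] /resolvent_setP[M M0 [_ MP]]; apply: phi0.
apply/rnorm0_eq0/eqP; rewrite eq_le rnorm_ge0 andbT (le_trans (MP _ Dphi)) //.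
by rewrite /= opprK Aphi scaleNr addNr rnorm0 mulr0.
Qed.

(** phi is in the kernel of lambda - A, the generator of e^{t lambda} S t. *)
Lemma eigenvector_orbit A S (lambda : R[i]) (phi : E) :
  C0_semigroup S -> generator S (opp_op A) -> eigenpair A lambda phi ->
  forall t, 0 <= t -> cexp lambda t *: S t phi = phi.
Proof.
move=> S0 SA [_ Dphi Aphi] t t0; rewrite -rescaleE.
apply: (generator0_invariant (rescale_C0 lambda S0)
  (rescale_generator lambda SA)) => //.
by rewrite /= Aphi subrr.
Qed.

Lemma eigenvector_superinvariant A S T (lambda : R[i]) (phi : E) :
  C0_semigroup S -> generator S (opp_op A) -> dominated S T ->
  eigenpair A lambda phi -> forall t, 0 <= t ->
  modulus phi <=E (expR (t * complex.Re lambda))%:C *: T t (modulus phi).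
Proof.
move=> S0 SA ST phiA t t0; rewrite -{1}(eigenvector_orbit S0 SA phiA t0).
apply: (cone_le_trans (modulusZ_le _ _)); rewrite norm_cexp.
by apply: cone_leZ (ST _ _ t0); exact: expR_ge0.
Qed.

Lemma resolvent_bound B T (a m : R) (psi rho : E) (c : R) :
  C0_semigroup T -> generator T (opp_op B) -> positive_semigroup T ->
  (spectral_bound (opp_op B) < m%:E)%E ->
  (forall t, 0 <= t -> psi <=E (expR (t * a))%:C *: T t psi) ->
  Epos rho -> 0 <= c -> Epos psi -> psi <=E c%:C *: rho ->
  psi <=E (c * `|a + m|)%:C *: inv_op (shift_op m%:C B) rho.
Proof.
move=> T0 TB Tpos sm psiT rho0 c0 psi0 psic.
have Bres n : m <= n -> resolvent_set (opp_op B) n%:C.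
  by move=> mn; apply: spectral_bound_resolvent; rewrite (lt_le_trans sm) ?lee_fin.
have [m0 m0P] := resolvent_pos_large T0 TB Tpos.
have Bpos := resolvent_pos_down Bres m0P.
have [M _ [Bex _]] := resolvent_setP (Bres _ (lexx m)).
have [u [Du uP]] := Bex psi.
have [Dw wP] : op_dom B (inv_op (shift_op m%:C B) rho) /\
    shift_op m%:C B (inv_op (shift_op m%:C B) rho) = rho.
  apply: (@inv_opP _ _ (shift_op m%:C B)); have [w [Dw wP]] := Bex rho.
  by exists w; split => //; rewrite -wP /= opprK.
set w := inv_op _ _ in Dw wP *.
have u0 : Epos u by apply: Bpos => //; rewrite uP.
(* Monotonicity of (m + B)^-1 applied to psi <= c rho. *)
have uw : u <=E c%:C *: w.
  have Dcw : op_dom (opp_op B) (c%:C *: w) by exact: op_domZ.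
  apply: Bpos; first exact: op_domB.
  rewrite resolvent_opB // uP op_funZ // scalerA mulrC -scalerA -scalerBr.
  suff -> : m%:C *: w - opp_op B w = rho by [].
  by rewrite -[RHS]wP /= opprK.
(* The semigroup e^{ta} T t has generator a - B, and (a + m) - (a - B) = m + B, so its resolvent at
   a + m is the positive (m + B)^-1. *)
have pu : psi <=E (a + m)%:C *: u.
  apply: (@resolvent_superinvariant _ _ (rescale a%:C T)
    (shift_op a%:C (opp_op B)) (a + m)).
  - exact: rescale_C0.
  - exact: rescale_generator.
  - move=> v Dv; rewrite rmorphD scalerDl opprD addrACA subrr add0r; exact: Bpos.
  - by move=> t t0; rewrite rescaleE cexp_real; exact/psiT/ltW.
  - by [].
  - by rewrite rmorphD scalerDl opprD addrACA subrr add0r.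
apply: (cone_le_trans pu).
apply: (@cone_le_trans _ _ (`|a + m|%:C *: u)).
  by apply: cone_leZr => //; exact: ler_norm.
by rewrite mulrC rmorphM -scalerA; exact: cone_leZ.
Qed.

End EigenvectorBounds.

(* S t is e^{-tA} and T t is e^{-tB}. *)
Theorem proposition3p4 (R : realType) (E : complexBanachLatticeType R)
  (rho : E) (rho_pos : Epos rho)
  (A : operator E) (S : R -> {linear E -> E})
  (S_C0 : C0_semigroup S) (S_gen : generator S (opp_op A)) :
  (forall (B : operator E) (T : R -> {linear E -> E}),
     C0_semigroup T -> generator T (opp_op B) -> dominated S T ->
     forall (lambda : R[i]) (phi : E),
       eigenpair A lambda phi -> gauge_space rho phi ->
       (forall mu : R[i],
          (maxe (spectral_bound (opp_op A)) (spectral_bound (opp_op B))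
             < (complex.Re mu)%:E)%E ->
          modulus phi <=E
            (gauge_norm rho phi * `|complex.Re (lambda + mu)|)%:C *:
              inv_op (shift_op (complex.Re mu)%:C B) rho) /\
       (forall t : R, 0 < t ->
          modulus phi <=E
            (gauge_norm rho phi * expR (t * complex.Re lambda))%:C *: T t rho)) /\
  (positive_semigroup S ->
     dominated S S /\
     forall (lambda : R[i]) (phi : E),
       eigenpair A lambda phi -> gauge_space rho phi ->
       let s := spectral_bound (opp_op A) in
       (* s(-A) is finite, so that fine s is its value *)
       s \is a fin_num /\
       (forall delta : R, 0 < delta ->
          modulus phi <=E
            (gauge_norm rho phi * (complex.Re lambda + fine s + delta))%:C *:
              inv_op (shift_op (fine s + delta)%:C A) rho) /\
       (forall t : R, 0 < t ->
          modulus phi <=E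
            (gauge_norm rho phi * expR (t * complex.Re lambda))%:C *: S t rho)).
Proof.
(* Stated for real m, this serves both halves: with (B, T) as given, and with (A, S) when S is
   positive. *)
have main (B : operator E) (T : R -> {linear E -> E}) :
    C0_semigroup T -> generator T (opp_op B) -> dominated S T ->
    forall (lambda : R[i]) (phi : E),
    eigenpair A lambda phi -> gauge_space rho phi ->
    (forall m : R, (spectral_bound (opp_op B) < m%:E)%E ->
       modulus phi <=E (gauge_norm rho phi * `|complex.Re lambda + m|)%:C *:
         inv_op (shift_op m%:C B) rho) /\
    (forall t : R, 0 < t ->
       modulus phi <=E
         (gauge_norm rho phi * expR (t * complex.Re lambda))%:C *: T t rho).
  move=> T_C0 T_gen ST lambda phi phiA /gauge_norm_le[g0 phig].
  have phiT := eigenvector_superinvariant S_C0 S_gen ST phiA.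
  split=> [m sm|t t0].
    apply: (resolvent_bound T_C0 T_gen (dominated_positive ST)) => //.
    exact: modulus_ge0.
  apply: (cone_le_trans (phiT t (ltW t0))); rewrite [gauge_norm _ _ * _]mulrC rmorphM -scalerA.
  apply: cone_leZ; first exact: expR_ge0.
  rewrite /cone_le -linearZ -linearB.
  exact: (dominated_positive ST (ltW t0)).
split=> [B T T_C0 T_gen ST lambda phi phiA phirho|Spos].
  have [bR bT] := main B T T_C0 T_gen ST lambda phi phiA phirho.
  split=> // mu; rewrite gt_max => /andP[_ /bR].
  by case: lambda {bR bT phiA} => a b; case: mu.
have SS := positive_dominated Spos; split => // lambda phi phiA phirho s.
have [bR bT] := main A S S_C0 S_gen SS lambda phi phiA phirho.
(* This keeps s above -oo and makes Re lambda + s + delta nonnegative, which removes the absolute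
   value. *)
have ls : (- (complex.Re lambda)%:E <= s)%E.
  apply: ereal_sup_ubound; exists (- lambda); first exact: (eigenvalue_spectrum phiA).
  by case: (lambda).
have s_fin : s \is a fin_num.
  (* The half-plane of resolvent points bounds the spectrum on the right, so s is not +oo. *)
  have [M MP] := resolvent_half_plane S_C0 S_gen.
  have sM : (s <= M%:E)%E.
    apply: ub_ereal_sup => _ [z zs <-]; rewrite lee_fin leNgt.
    by apply/negP => /MP.
  by rewrite fin_numElt (lt_le_trans _ ls) ?ltNyr //= (le_lt_trans sM) ?ltry.
split => //; split=> // delta d0.
have ls' : - complex.Re lambda <= fine s by rewrite -lee_fin fineK.
rewrite -(ger0_norm (_ : 0 <= complex.Re lambda + fine s + delta)); last by lra.
rewrite -addrA; apply: bR.
by rewrite -/s -[s in (s < _)%E]fineK // lte_fin ltrDl.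
Qed.
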